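(* Let $m\ge 1$, $1\le p<\infty$, let $X$ be any one of the four sets $\widetilde{S}^{m}$, $E^{m}$, $S_0^{m}$, $S^{m}$, and let $U\subset X$. Let $\overline{U}$ denote the closure of $U$ in $(F_B(\mathbb{R}^m)^p,d_p)$. Then $U$ is relatively compact in $(X,d_p)$ if and only if (i) $U$ is uniformly $p$-mean bounded; (ii) $U$ is $p$-mean equi-left-continuous; and (iii) $\overline{U}\subset X$.
   Context: $H$ is the Hausdorff metric on nonempty closed subsets of $\mathbb{R}^m$ (Euclidean distance): $H(A,B)=\max\{\sup_{a\in A}\inf_{b\in B}d(a,b),\ \sup_{b\in B}\inf_{a\in A}d(a,b)\}$ (possibly $+\infty$). A fuzzy set on $\mathbb{R}^m$ is a function $u:\mathbb{R}^m\to[0,1]$; its cuts are $[u]_\alpha=\{x: u(x)\ge\alpha\}$ for $\alpha\in(0,1]$ and $[u]_0=\overline{\{x: u(x)>0\}}$. $F_B(\mathbb{R}^m)$ is the set of fuzzy sets $u$ on $\mathbb{R}^m$ that are normal ($u(x_0)=1$ for some $x_0$), upper semi-continuous, and have $[u]_0$ bounded. $F_B(\mathbb{R}^m)^p\supset F_B(\mathbb{R}^m)$ is the set of normal upper semi-continuous fuzzy sets $u$ with $\left(\int_0^1 H([u]_\alpha,\{0\})^p\,d\alpha\right)^{1/p}<+\infty$, where $0$ is the origin. The metric is $d_p(u,v)=\left(\int_0^1 H([u]_\alpha,[v]_\alpha)^p\,d\alpha\right)^{1/p}$. Subsets of $F_B(\mathbb{R}^m)$: - $E^{m}$: those $u$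 that are fuzzy convex, i.e. $u(\lambda x+(1-\lambda)y)\ge\min\{u(x),u(y)\}$ for all $x,y\in\mathbb{R}^m$, $\lambda\in[0,1]$; - $S_0^{m}$: those $u$ with $u(\lambda y)\ge u(y)$ for all $y\in\mathbb{R}^m$, $\lambda\in[0,1]$; - $S^{m}$: those $u$ for which there is $x\in\mathbb{R}^m$ with $u(\lambda y+(1-\lambda)x)\ge u(y)$ for all $y\in\mathbb{R}^m$, $\lambda\in[0,1]$; - $\widetilde{S}^{m}$: those $u$ such that for every $\alpha\in(0,1]$ there is $x_\alpha\in[u]_\alpha$ such that for all $y\in[u]_\alpha$ the segment $\overline{x_\alpha y}$ is contained in $[u]_\alpha$. A set $U\subset F_B(\mathbb{R}^m)^p$ is uniformly $p$-mean bounded if there is $M>0$ with $d_p(u,\widehat{0})\le M$ for all $u\in U$, where $\widehat 0$ is the characteristic function of $\{0\}$. $U$ is $p$-mean equi-left-continuous if for every $\varepsilon>0$ there is $\delta>0$ such that for all $0\le h<\delta$ and all $u\in U$, $\left(\int_h^1 H([u]_\alpha,[u]_{\alpha-h})^p\,d\alpha\right)^{1/p}<\varepsilon$. A subset of a metric space $X$ is relatively compact in $X$ if its closure in $X$ is compact. *)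

(* Defs.v *)
From HB Require Import structures.
From mathcomp Require Import all_boot all_order all_algebra.
From mathcomp Require Import all_classical all_reals all_analysis.

Set Implicit Arguments.
Unset Strict Implicit.
Unset Printing Implicit Defensive.

Import Order.TTheory GRing.Theory Num.Theory.
Import numFieldNormedType.Exports.

Local Open Scope classical_set_scope.
Local Open Scope ring_scope.

(* R^m is 'rV[R]_m. The library's norm on 'rV[R]_m is the sup norm, so the
   Euclidean distance is defined explicitly; the topology and the bounded sets
   of 'rV[R]_m are the same for both norms. *)
Definition euclid_dist (R : realType) (m : nat) (x y : 'rV[R]_m) : R :=
  Num.sqrt (\sum_(i < m) (x ord0 i - y ord0 i) ^+ 2).

Definition hausdorff_dist (R : realType) (m : nat) (A B : set 'rV[R]_m) :
    \bar R :=
  Order.max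
    (ereal_sup [set ereal_inf [set (euclid_dist a b)%:E | b in B] | a in A])
    (ereal_sup [set ereal_inf [set (euclid_dist a b)%:E | a in A] | b in B]).

Definition is_fuzzy (R : realType) (m : nat) (u : 'rV[R]_m -> R) : Prop :=
  forall x, 0 <= u x <= 1.

(* Only meant for 0 <= alpha <= 1. *)
Definition alpha_cut (R : realType) (m : nat) (u : 'rV[R]_m -> R) (alpha : R) :
    set 'rV[R]_m :=
  if alpha == 0 then closure [set x | 0 < u x] else [set x | alpha <= u x].

Definition normal_fuzzy (R : realType) (m : nat) (u : 'rV[R]_m -> R) : Prop :=
  exists x0, u x0 = 1.

Definition upper_semicontinuous (R : realType) (m : nat)
    (u : 'rV[R]_m -> R) : Prop :=
  forall (x : 'rV[R]_m) (a : R), u x < a -> \forall y \near x, u y < a.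

Definition F_B (R : realType) (m : nat) : set ('rV[R]_m -> R) :=
  [set u | [/\ is_fuzzy u, normal_fuzzy u, upper_semicontinuous u &
               bounded_set (alpha_cut u 0)]].
Arguments F_B : clear implicits.

Definition F_Bp (R : realType) (m : nat) (p : R) : set ('rV[R]_m -> R) :=
  [set u | [/\ is_fuzzy u, normal_fuzzy u, upper_semicontinuous u &
     ((\int[lebesgue_measure]_(alpha in `[0%R, 1%R])
         (hausdorff_dist (alpha_cut u alpha) [set 0%R]) `^ p) `^ p^-1
      < +oo)%E]].
Arguments F_Bp : clear implicits.

Definition dp (R : realType) (m : nat) (p : R) (u v : 'rV[R]_m -> R) : \bar R :=
  ((\int[lebesgue_measure]_(alpha in `[0%R, 1%R])
      (hausdorff_dist (alpha_cut u alpha) (alpha_cut v alpha)) `^ p) `^ p^-1)%E.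

Definition Em (R : realType) (m : nat) : set ('rV[R]_m -> R) :=
  [set u | F_B R m u /\
     forall (x y : 'rV[R]_m) (l : R), 0 <= l <= 1 ->
       Num.min (u x) (u y) <= u (l *: x + (1 - l) *: y)].
Arguments Em : clear implicits.

Definition S0m (R : realType) (m : nat) : set ('rV[R]_m -> R) :=
  [set u | F_B R m u /\
     forall (y : 'rV[R]_m) (l : R), 0 <= l <= 1 -> u y <= u (l *: y)].
Arguments S0m : clear implicits.

Definition Sm (R : realType) (m : nat) : set ('rV[R]_m -> R) :=
  [set u | F_B R m u /\
     exists x : 'rV[R]_m, forall (y : 'rV[R]_m) (l : R), 0 <= l <= 1 ->
       u y <= u (l *: y + (1 - l) *: x)].
Arguments Sm : clear implicits.

Definition line_segment (R : realType) (m : nat) (x y : 'rV[R]_m) :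
    set 'rV[R]_m :=
  [set l *: y + (1 - l) *: x | l in [set l : R | 0 <= l <= 1]].

Definition Stilde (R : realType) (m : nat) : set ('rV[R]_m -> R) :=
  [set u | F_B R m u /\
     forall alpha : R, 0 < alpha <= 1 ->
       exists2 x : 'rV[R]_m, alpha_cut u alpha x &
         forall y, alpha_cut u alpha y ->
           line_segment x y `<=` alpha_cut u alpha].
Arguments Stilde : clear implicits.

Definition zero_hat (R : realType) (m : nat) : 'rV[R]_m -> R := \1_[set 0].
Arguments zero_hat : clear implicits.

Definition uniformly_p_mean_bounded (R : realType) (m : nat) (p : R)
    (U : set ('rV[R]_m -> R)) : Prop :=
  exists2 M : R, 0 < M & forall u, U u -> (dp p u (zero_hat R m) <= M%:E)%E.

(* For h > 1 the domain `[h, 1] is empty and the condition is vacuous. *)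
Definition p_mean_equi_left_continuous (R : realType) (m : nat) (p : R)
    (U : set ('rV[R]_m -> R)) : Prop :=
  forall eps : R, 0 < eps -> exists2 delta : R, 0 < delta &
    forall h : R, 0 <= h < delta -> forall u, U u ->
      ((\int[lebesgue_measure]_(alpha in `[h, 1%R])
          (hausdorff_dist (alpha_cut u alpha) (alpha_cut u (alpha - h)%R)) `^ p)
        `^ p^-1
        < eps%:E)%E.

(* The metric space (X, d_p): the subtype of X with the metric topology of d_p,
   whose open sets are the sets containing a d_p-ball around each of their
   points. *)
Definition dp_space (R : realType) (m : nat) (p : R)
  (X : set ('rV[R]_m -> R)) : Type := set_type X.

Section dp_topology.
Context (R : realType) (m : nat) (p : R) (X : set ('rV[R]_m -> R)).

HB.instance Definition _ := Choice.copy (dp_space p X) (set_type X).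

Definition dp_val (u : dp_space p X) : 'rV[R]_m -> R := set_val u.

Definition dp_open (W : set (dp_space p X)) : Prop :=
  forall u, W u -> exists2 eps : R, 0 < eps &
    forall v, (dp p (dp_val u) (dp_val v) < eps%:E)%E -> W v.

Let dp_openT : dp_open setT.
Proof. by move=> u _; exists 1. Qed.

Let dp_openI : setI_closed dp_open.
Proof.
move=> A B oA oB u [/oA[e e0 Ae] /oB[d d0 Bd]].
exists (Num.min e d); first by rewrite lt_min e0.
move=> v uv; split; [apply: Ae|apply: Bd]; apply: (lt_le_trans uv);
  by rewrite lee_fin ge_min lexx ?orbT.
Qed.

Let dp_open_bigU (I : Type) (f : I -> set (dp_space p X)) :
  (forall i, dp_open (f i)) -> dp_open (\bigcup_i f i).
Proof.
move=> of_ u [i _ /of_[e e0 fe]]; exists e => // v uv.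
by exists i => //; exact: fe.
Qed.

HB.instance Definition _ := isOpenTopological.Build (dp_space p X)
  dp_openT dp_openI dp_open_bigU.

End dp_topology.

Definition dp_closure (R : realType) (m : nat) (p : R)
    (X U : set ('rV[R]_m -> R)) : set ('rV[R]_m -> R) :=
  @dp_val R m p X @` closure (@dp_val R m p X @^-1` U).

Definition dp_relatively_compact (R : realType) (m : nat) (p : R)
    (X U : set ('rV[R]_m -> R)) : Prop :=
  compact (closure (@dp_val R m p X @^-1` U)).

(* Main.v *)
(** Compactness is tested on ultrafilters.  An ultrafilter [G] on [U] has, for
    every level [a] in ]0, 1], a Kuratowski limit [K a] of the cuts [[u]_a], and
    since the cuts are uniformly bounded this is a limit for the Hausdorff metric.
    The [K a] decrease in [a], so [w x = sup {a | K a x}] is upper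
    semicontinuous with [K a] inside [[w]_a] inside [K b] for [b < a].  Integrals
    do not pass to the limit along an ultrafilter; instead, on a grid of mesh [h]
    monotonicity of the cuts gives
    [H([u]_a, [w]_a) <= eta + H([u]_a, [u]_(a-h)) + H([u]_(a+h), [u]_a)],
    where [eta] only involves finitely many levels, and the two other terms are
    small in p-mean by equi-left-continuity.  Near [a = 0] the same condition
    makes the p-th powers of the radii uniformly integrable.  Hence [G] converges
    to [w] in [F_Bp], and [w] lies in [X] by (iii).

    For the converse, (i) and (ii) pass from the points of the closure, which have
    bounded support, to [U] by compactness, and (iii) holds because [d_p] separates
    points.  Minkowski's inequality is avoided throughout: the quasi-triangle
    inequality coming from [(x + y)^p <= 2^p (x^p + y^p)] suffices. *)
From HB Require Import structures.
Require Import Defs.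
From mathcomp Require Import all_boot all_order all_algebra.
From mathcomp Require Import all_classical all_reals all_analysis.
From mathcomp Require Import measurable_realfun ring lra.

Set Implicit Arguments.
Unset Strict Implicit.
Unset Printing Implicit Defensive.

Import Order.TTheory GRing.Theory Num.Theory.
Import numFieldNormedType.Exports.

Local Open Scope classical_set_scope.
Local Open Scope ring_scope.

(** * Euclidean distance on row vectors *)

Section euclidean_distance.
Context {R : realType} {m : nat}.
Implicit Types (x y z : 'rV[R]_m) (A B C : set 'rV[R]_m).

(** Lagrange's identity: the squares [(f i * g j - f j * g i) ^+ 2], summed over all pairs, give
    twice the difference of the two sides. *)
Lemma cauchy_schwarz_sum (f g : 'I_m -> R) :
  (\sum_i f i * g i) ^+ 2 <= (\sum_i f i ^+ 2) * (\sum_i g i ^+ 2).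
Proof.
have H : 0 <= \sum_i \sum_j (f i * g j - f j * g i) ^+ 2.
  by apply: sumr_ge0 => i _; apply: sumr_ge0 => j _; exact: sqr_ge0.
suff E : \sum_i \sum_j (f i * g j - f j * g i) ^+ 2 =
    2 * ((\sum_i f i ^+ 2) * (\sum_i g i ^+ 2) - (\sum_i f i * g i) ^+ 2).
  by move: H; rewrite E pmulr_rge0// subr_ge0.
have -> : \sum_i \sum_j (f i * g j - f j * g i) ^+ 2 =
    \sum_i \sum_j (f i ^+ 2 * g j ^+ 2) + \sum_i \sum_j (g i ^+ 2 * f j ^+ 2)
    - 2 * \sum_i \sum_j ((f i * g i) * (f j * g j)).
  rewrite mulr_sumr -big_split -sumrB; apply: eq_bigr => i _ /=.
  rewrite mulr_sumr -big_split -sumrB; apply: eq_bigr => j _ /=.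
  ring.
have sumM (a b : 'I_m -> R) :
    \sum_i \sum_j a i * b j = (\sum_i a i) * (\sum_j b j).
  by rewrite mulr_suml; apply: eq_bigr => i _; rewrite mulr_sumr.
by rewrite !sumM; ring.
Qed.

Lemma euclid_dist_ge0 x y : 0 <= euclid_dist x y.
Proof. exact: sqrtr_ge0. Qed.

Lemma euclid_dist_sym x y : euclid_dist x y = euclid_dist y x.
Proof.
by rewrite /euclid_dist; congr Num.sqrt; apply: eq_bigr => i _; rewrite -sqrrN opprB.
Qed.

Lemma euclid_distxx x : euclid_dist x x = 0.
Proof.
rewrite /euclid_dist big1 ?sqrtr0// => i _.
by rewrite subrr expr0n.
Qed.

Lemma euclid_dist_triangle y x z :
  euclid_dist x z <= euclid_dist x y + euclid_dist y z.
Proof.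
set f := fun i : 'I_m => x ord0 i - y ord0 i.
set g := fun i : 'I_m => y ord0 i - z ord0 i.
have fg : euclid_dist x z = Num.sqrt (\sum_i (f i + g i) ^+ 2).
  by rewrite /euclid_dist; congr Num.sqrt; apply: eq_bigr => i _; rewrite /f /g; ring.
have f0 : 0 <= \sum_i f i ^+ 2 by apply: sumr_ge0 => i _; exact: sqr_ge0.
have g0 : 0 <= \sum_i g i ^+ 2 by apply: sumr_ge0 => i _; exact: sqr_ge0.
rewrite fg -[leRHS]ger0_norm ?addr_ge0 ?euclid_dist_ge0// -sqrtr_sqr ler_wsqrtr//.
rewrite sqrrD !sqr_sqrtr//.
have -> : \sum_i (f i + g i) ^+ 2 =
   \sum_i f i ^+ 2 + (\sum_i f i * g i) *+ 2 + \sum_i g i ^+ 2.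
  rewrite -sumrMnl -!big_split/=; apply: eq_bigr => i _; ring.
rewrite lerD2r lerD2l lerMn2r/= (le_trans (ler_norm _))// -sqrtr_sqr.
by rewrite -sqrtrM// ler_wsqrtr// cauchy_schwarz_sum.
Qed.

Lemma norm_le_euclid_dist x y : `|x - y| <= euclid_dist x y.
Proof.
rewrite [leLHS]/Num.Def.normr/= mx_normrE.
apply: bigmax_le => [|[i j] _ /=]; first exact: euclid_dist_ge0.
rewrite !mxE ord1 -sqrtr_sqr ler_wsqrtr// (bigD1 j)//= lerDl.
by apply: sumr_ge0 => k _; exact: sqr_ge0.
Qed.

(** The crude factor [m] in place of its square root suffices: only the equivalence with the sup
    norm is used. *)
Lemma euclid_dist_le_norm x y : euclid_dist x y <= m%:R * `|x - y|.
Proof.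
have H0 : 0 <= m%:R * `|x - y| by rewrite mulr_ge0.
rewrite -[leRHS]ger0_norm// -sqrtr_sqr ler_wsqrtr// exprMn.
have : \sum_(i < m) (x ord0 i - y ord0 i) ^+ 2 <= \sum_(i < m) `|x - y| ^+ 2.
  apply: ler_sum => i _; rewrite -[leLHS]real_normK ?num_real// lerXn2r ?nnegrE//.
  have -> : x ord0 i - y ord0 i = (x - y) ord0 i by rewrite !mxE.
  rewrite [leRHS]/Num.Def.normr/= mx_normrE.
  by apply: (le_bigmax _ (fun ij : 'I_1 * 'I_m => `|(x - y) ij.1 ij.2|) (ord0, i)).
rewrite sumr_const card_ord -[_ *+ m]mulr_natl => /le_trans; apply.
rewrite ler_wpM2r ?sqr_ge0//.
rewrite -natrX ler_nat; case: m => // n.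
by rewrite leq_exp2l// || rewrite -[leqLHS]muln1 leq_mul.
Qed.

Lemma euclid_dist_near x (e : R) : 0 < e -> \forall y \near x, euclid_dist x y < e.
Proof.
move=> e0; near=> y.
rewrite (le_lt_trans (euclid_dist_le_norm _ _))//.
(* [m.+1] makes the divisor positive for every [m]. *)
rewrite (@le_lt_trans _ _ (m.+1%:R * `|x - y|)) ?ler_wpM2r ?ler_nat//.
rewrite -ltr_pdivlMl//; near: y.
by apply: cvgr_dist_lt => //; rewrite mulr_gt0// invr_gt0.
Unshelve. all: by end_near. Qed.

Lemma euclid_dist_nbhs x (P : set 'rV[R]_m) :
  nbhs x P <-> exists2 e : R, 0 < e & forall y, euclid_dist x y < e -> P y.
Proof.
split.
  move=> /nbhs_ballP[e /= e0 xP]; exists e => // y xy.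
  apply: xP; rewrite -ball_normE /ball_/= (le_lt_trans _ xy)//.
  exact: norm_le_euclid_dist.
move=> [e e0 xP]; near=> y; apply: xP; near: y; exact: euclid_dist_near.
Unshelve. all: by end_near. Qed.

Lemma euclid_dist_rat x (e : R) : 0 < e ->
  exists q : 'rV[rat]_m, euclid_dist x (map_mx ratr q) < e.
Proof.
move=> e0; have e1 : 0 < e / m.+1%:R by rewrite divr_gt0.
have H (i : 'I_m) : exists q : rat, `|x ord0 i - ratr q| < e / m.+1%:R.
  have [|q] := @rat_in_itvoo R (x ord0 i - e / m.+1%:R) (x ord0 i + e / m.+1%:R).
    by rewrite ltrD2l gtrN.
  rewrite in_itv/= => /andP[a b]; exists q.
  by rewrite ltr_distlC a.
have [q qP] := choice H.
exists (\row_i q i); apply: (le_lt_trans (euclid_dist_le_norm _ _)).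
have : `|x - map_mx ratr (\row_i q i)| <= e / m.+1%:R.
  rewrite [leLHS]/Num.Def.normr/= mx_normrE.
  apply: bigmax_le => [|[i j] _ /=]; first exact: ltW.
  by rewrite !mxE ord1 ltW.
move=> H1; apply: (@le_lt_trans _ _ (m%:R * (e / m.+1%:R))).
  by rewrite ler_wpM2l.
by rewrite mulrCA gtr_pMr// ltr_pdivrMr// mul1r ltr_nat.
Qed.

End euclidean_distance.

(** * One-sided Hausdorff distance *)

Section hausdorff_excess.
Context {R : realType} {m : nat}.
Implicit Types (x y z : 'rV[R]_m) (A B C : set 'rV[R]_m).
Local Open Scope ereal_scope.

Definition excess A B : \bar R :=
  ereal_sup [set ereal_inf [set (euclid_dist a b)%:E | b in B] | a in A].

Lemma hausdorff_distE A B : hausdorff_dist A B = maxe (excess A B) (excess B A).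
Proof.
rewrite /hausdorff_dist /excess; congr (Order.max _ (ereal_sup _)).
apply: eq_imagel => b _; congr ereal_inf; apply: eq_imagel => a _.
by rewrite euclid_dist_sym.
Qed.

(** The slack [e] is there because the infimum over [B] need not be attained. *)
Lemma excess_le A B (r : R) :
  (forall a, A a -> forall e : R, (0 < e)%R ->
     exists2 b, B b & (euclid_dist a b <= r + e)%R) ->
  excess A B <= r%:E.
Proof.
move=> H; apply: ge_ereal_sup => _ [a Aa <-].
apply/lee_addgt0Pr => e e0.
have [b Bb ab] := H _ Aa _ e0.
by apply: ge_ereal_inf; exists (euclid_dist a b)%:E; [exists b|rewrite lee_fin].
Qed.

Lemma excess_far A B (r : R) : ~ (excess A B <= r%:E) ->
  exists2 a, A a & forall b, B b -> (r < euclid_dist a b)%R.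
Proof.
move=> ABr; apply/not_exists2P => /= near; apply: ABr.
apply: excess_le => a Aa e e0.
have [b Bb ab] : exists2 b, B b & (euclid_dist a b <= r)%R.
  apply/not_exists2P => far; case: (near a) => // nr; apply: nr => b Bb.
  by rewrite ltNge; apply/negP; case: (far b).
by exists b => //; rewrite (le_trans ab)// lerDl ltW.
Qed.

Lemma excess_lt A B (r : R) a : excess A B < r%:E -> A a ->
  exists2 b, B b & (euclid_dist a b < r)%R.
Proof.
move=> ABr Aa.
have : ereal_inf [set (euclid_dist a b)%:E | b in B] < r%:E.
  by apply: le_lt_trans ABr; apply: ereal_sup_ubound; exists a.
by move=> /ereal_inf_lt[_ [b Bb <-]]; rewrite lte_fin => ?; exists b.
Qed.

(** The supremum over an empty [A] would be [-oo], hence the nonemptiness hypotheses from here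
    on. *)
Lemma excess_ge0 A B : A !=set0 -> 0 <= excess A B.
Proof.
move=> [a Aa]; apply: le_ereal_sup_tmp.
exists (ereal_inf [set (euclid_dist a b)%:E | b in B]); first by exists a.
by apply: le_ereal_inf_tmp => _ [b Bb <-]; rewrite lee_fin euclid_dist_ge0.
Qed.

Lemma excess_mono A A' B B' : A `<=` A' -> B' `<=` B ->
  excess A B <= excess A' B'.
Proof.
move=> AA BB; apply: ge_ereal_sup => _ [a Aa <-]; apply: le_ereal_sup_tmp.
exists (ereal_inf [set (euclid_dist a b)%:E | b in B']).
  by exists a => //; exact: AA.
apply: ereal_inf_le_tmp => _ [b Bb <-]; exists b => //; exact: BB.
Qed.

Lemma excess_sub A B : A `<=` B -> excess A B <= 0.
Proof.
move=> AB; apply: excess_le => a Aa e e0; exists a; first exact: AB.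
by rewrite euclid_distxx add0r ltW.
Qed.

Lemma excess_triangle B A C : A !=set0 -> B !=set0 ->
  excess A C <= excess A B + excess B C.
Proof.
move=> A0 B0.
have e1 := excess_ge0 B A0; have e2 := excess_ge0 C B0.
(* An infinite summand makes the bound trivial; nonnegativity excludes [-oo], so that the sum is
   never of the form [+oo - oo]. *)
case E1 : (excess A B) e1 => [r1||] // e1; last by rewrite addye ?leey// gt_eqF// (lt_le_trans _ e2).
case E2 : (excess B C) e2 => [r2||] // e2; last by rewrite addey ?leey.
rewrite -EFinD; apply: excess_le => a Aa e e0.
have [|b Bb ab] := @excess_lt A B (r1 + e / 2)%R a _ Aa.
  by rewrite E1 lte_fin ltrDl divr_gt0.
have [|c Cc bc] := @excess_lt B C (r2 + e / 2)%R b _ Bb.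
  by rewrite E2 lte_fin ltrDl divr_gt0.
exists c => //; rewrite (le_trans (euclid_dist_triangle b _ _))//; lra.
Qed.

Lemma hausdorff_distC A B : hausdorff_dist A B = hausdorff_dist B A.
Proof. by rewrite !hausdorff_distE maxC. Qed.

Lemma excess_le_hausdorff A B : excess A B <= hausdorff_dist A B.
Proof. by rewrite hausdorff_distE le_max lexx. Qed.

Lemma excess_le_hausdorffC A B : excess A B <= hausdorff_dist B A.
Proof. by rewrite hausdorff_distE le_max lexx orbT. Qed.

Lemma hausdorff_dist_ge0 A B : A !=set0 -> 0 <= hausdorff_dist A B.
Proof. by move=> A0; rewrite (le_trans (excess_ge0 B A0))// excess_le_hausdorff. Qed.

Lemma hausdorff_dist_triangle B A C : A !=set0 -> B !=set0 -> C !=set0 ->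
  hausdorff_dist A C <= hausdorff_dist A B + hausdorff_dist B C.
Proof.
move=> A0 B0 C0; rewrite [leLHS]hausdorff_distE ge_max; apply/andP; split.
  by rewrite (le_trans (excess_triangle C A0 B0))// leeD ?excess_le_hausdorff.
rewrite (le_trans (excess_triangle A C0 B0))// addeC.
by rewrite leeD ?excess_le_hausdorffC.
Qed.

Lemma hausdorff_distxx A : A !=set0 -> hausdorff_dist A A = 0.
Proof.
move=> A0; apply/eqP; rewrite eq_le hausdorff_dist_ge0// andbT.
by rewrite hausdorff_distE maxxx excess_sub.
Qed.

Lemma excess_set0_lt A (r : R) : hausdorff_dist A [set 0%R] < r%:E ->
  forall a, A a -> (euclid_dist a 0 < r)%R.
Proof.
move=> H a Aa; have [|_ /= -> //] := @excess_lt A [set 0%R] r a _ Aa.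
by rewrite (le_lt_trans _ H)// excess_le_hausdorff.
Qed.

Lemma hausdorff_dist_set0_le A (r : R) : A !=set0 ->
  (forall a, A a -> euclid_dist a 0 <= r)%R -> hausdorff_dist A [set 0%R] <= r%:E.
Proof.
move=> [a0 Aa0] H; rewrite hausdorff_distE ge_max; apply/andP; split.
  apply: excess_le => a Aa e e0; exists 0%R => //.
  by rewrite (le_trans (H _ Aa))// lerDl ltW.
apply: excess_le => _ -> e e0; exists a0 => //.
by rewrite euclid_dist_sym (le_trans (H _ Aa0))// lerDl ltW.
Qed.

(** Real-valued, so that two such distances can be subtracted. *)
Definition point_dist x A : R := inf [set euclid_dist x a | a in A].

Lemma point_dist_has_inf x A : A !=set0 -> has_inf [set euclid_dist x a | a in A].
Proof.
move=> [a Aa]; split; first by exists (euclid_dist x a), a.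
by exists 0%R => _ [b Bb <-]; exact: euclid_dist_ge0.
Qed.

Lemma point_dist_le x A a : A a -> (point_dist x A <= euclid_dist x a)%R.
Proof.
by move=> Aa; apply: ge_inf; [case: (point_dist_has_inf x (ex_intro _ a Aa))|exists a].
Qed.

Lemma point_dist_lt x A (r : R) : A !=set0 -> (point_dist x A < r)%R ->
  exists2 a, A a & (euclid_dist x a < r)%R.
Proof.
move=> A0 H; have e0 : (0 < r - point_dist x A)%R by rewrite subr_gt0.
have [_ [a Aa <-]] := inf_adherent e0 (point_dist_has_inf x A0).
by rewrite -/(point_dist x A) subrKC => ?; exists a.
Qed.

Lemma point_dist_mono x A B : A !=set0 -> A `<=` B ->
  (point_dist x B <= point_dist x A)%R.
Proof.
move=> A0 AB; rewrite leNgt; apply/negP => /(point_dist_lt A0)[a Aa].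
by rewrite ltNge => /negP; apply; apply: point_dist_le; exact: AB.
Qed.

(* A countable supremum of functions of [(A, B)] that are monotone in [A] and
   in [B]: this is what makes distances between level cuts measurable. *)
Lemma excess_rat_sup A B : A !=set0 -> B !=set0 -> excess A B =
  ereal_sup (range (fun q : 'rV[rat]_m =>
    (point_dist (map_mx ratr q) B - point_dist (map_mx ratr q) A)%:E)).
Proof.
move=> A0 B0; apply/eqP; rewrite eq_le; apply/andP; split; last first.
  apply: ge_ereal_sup => _ [q _ <-]; set x := map_mx _ _.
  have e1 := excess_ge0 B A0.
  case E : (excess A B) e1 => [r||]// r0; last by rewrite leey.
  rewrite lee_fin; apply/ler_addgt0Pr => e e0.
  have [|a Aa xa] := @point_dist_lt x A (point_dist x A + e / 2) A0.
    by rewrite ltrDl divr_gt0.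
  have [|b Bb ab] := @excess_lt A B (r + e / 2) a _ Aa.
    by rewrite E lte_fin ltrDl divr_gt0.
  have := point_dist_le x Bb; have := euclid_dist_triangle a x b; lra.
apply: ge_ereal_sup => _ [a Aa <-]; apply/lee_addgt0Pr => e e0.
(* Three errors of [e / 3]: the distance from [a] to [x] counts twice, and the choice of [b] costs
   the third. *)
have [q qe] := @euclid_dist_rat R m a (e / 3) (ltac:(by rewrite divr_gt0)).
set x := map_mx ratr q in qe.
have [|b Bb xb] := @point_dist_lt x B (point_dist x B + e / 3) B0.
  by rewrite ltrDl divr_gt0.
apply: (@le_trans _ _ ((point_dist x B - point_dist x A)%:E + e%:E)); last first.
  by rewrite leeD2r//; apply: ereal_sup_ubound; exists q.
apply: ge_ereal_inf; exists (euclid_dist a b)%:E; first by exists b.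
rewrite -EFinD lee_fin.
have := point_dist_le x Aa; have := euclid_dist_triangle x a b.
by rewrite (euclid_dist_sym x a); lra.
Qed.

End hausdorff_excess.

(** * Integrals of p-th powers *)

Section power_inequalities.
Context {R : realType} (p : R).
Hypothesis p1 : 1 <= p.
Implicit Types (x y z : \bar R).
Local Open Scope ereal_scope.

Let p_gt0 : (0 < p)%R. Proof. exact: lt_le_trans p1. Qed.

Lemma le_poweR x y : 0 <= x -> x <= y -> x `^ p <= y `^ p.
Proof.
move=> x0 xy; apply: gt0_ler_poweR => //; first exact: ltW.
  by rewrite in_itv/= x0 leey.
by rewrite in_itv/= (le_trans x0 xy) leey.
Qed.

Lemma poweRVK x : 0 <= x -> (x `^ p^-1) `^ p = x.
Proof. by move=> x0; rewrite -poweRrM mulVf ?gt_eqF// poweRe1. Qed.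

(** Removes the outer root of [dp], so that estimates can be made on integrals of p-th powers. *)
Lemma poweRV_lt x (e : R) : 0 <= x -> (0 < e)%R ->
  (x `^ p^-1 < e%:E) = (x < (e `^ p)%:E).
Proof.
move=> x0 e0.
have e1 : (e `^ p)%:E `^ p^-1 = e%:E.
  by rewrite poweR_EFin -powRrM mulfV ?gt_eqF// powRr1// ltW.
apply/idP/idP => H; rewrite ltNge; apply/negP => H1; move: H; apply/negP; rewrite -leNgt.
  rewrite -e1; apply: gt0_ler_poweR => //.
  - by rewrite invr_ge0 ltW.
  - by rewrite in_itv/= leey lee_fin powR_ge0.
  - by rewrite in_itv/= leey x0.
rewrite -poweR_EFin -[leRHS]poweRVK//.
by apply: le_poweR => //; rewrite lee_fin ltW.
Qed.

Lemma poweRV_le x (e : R) : 0 <= x -> (0 < e)%R ->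
  (x `^ p^-1 <= e%:E) = (x <= (e `^ p)%:E).
Proof.
move=> x0 e0.
have e1 : (e `^ p)%:E `^ p^-1 = e%:E.
  by rewrite poweR_EFin -powRrM mulfV ?gt_eqF// powRr1// ltW.
apply/idP/idP => H.
  by rewrite -[leLHS]poweRVK// -poweR_EFin le_poweR// poweR_ge0.
rewrite -e1; apply: gt0_ler_poweR => //.
- by rewrite invr_ge0 ltW.
- by rewrite in_itv/= leey x0.
- by rewrite in_itv/= leey lee_fin powR_ge0.
Qed.

(** Bounds the sum by twice the larger term; convexity of the power would give a better constant. *)
Lemma poweRD_le x y : 0 <= x -> 0 <= y ->
  (x + y) `^ p <= (2 `^ p)%:E * (x `^ p + y `^ p).
Proof.
wlog xy : x y / x <= y.
  move=> H x0 y0; have [xy|/ltW yx] := leP x y; first exact: H.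
  by rewrite addeC [X in _ * X]addeC H.
move=> x0 y0; apply: (@le_trans _ _ ((2%:E * y) `^ p)).
  apply: le_poweR; first exact: adde_ge0.
  by rewrite mule_natl mule2n leeD2r.
rewrite poweRM// poweR_EFin lee_pmul2l ?lte_fin ?powR_gt0//.
by rewrite leeDr// poweR_ge0.
Qed.

End power_inequalities.

(** Locked so that conversion does not unfold the integral; proofs that need its definition call
    [unlock]. *)
HB.lock Definition int_pow {R : realType} (p : R) (D : set R) (f : R -> \bar R) :
  \bar R := (\int[@lebesgue_measure R]_(a in D) (f a `^ p))%E.

Section integral_of_powers.
Context {R : realType} (p : R).
Hypothesis p1 : 1 <= p.
Local Open Scope ereal_scope.
Local Notation mu := (@lebesgue_measure R).
Local Notation int_pow := (int_pow p).
Implicit Types (D : set R) (f g k : R -> \bar R).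

Let p_gt0 : (0 < p)%R. Proof. exact: lt_le_trans p1. Qed.

Lemma measurable_pow D f : measurable_fun D f ->
  measurable_fun D (fun a : R => (f a) `^ p).
Proof. by move=> mf; exact: (measurableT_comp (measurable_poweR p)). Qed.

Lemma int_pow_ge0 D f : 0 <= int_pow D f.
Proof. by rewrite unlock; apply: integral_ge0 => a _; exact: poweR_ge0. Qed.

Lemma le_int_pow D f g : measurable D -> measurable_fun D f -> measurable_fun D g ->
  (forall a, D a -> 0 <= f a) -> (forall a, D a -> f a <= g a) ->
  int_pow D f <= int_pow D g.
Proof.
move=> mD mf mg f0 fg; rewrite unlock; apply: ge0_le_integral => //.
- by move=> a _; exact: poweR_ge0.
- exact: measurable_pow.
- exact: measurable_pow.
- by move=> a Da; apply: le_poweR => //; [exact: f0|exact: fg].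
Qed.

Lemma int_powD_le D f g k : measurable D ->
  measurable_fun D f -> measurable_fun D g -> measurable_fun D k ->
  (forall a, D a -> 0 <= f a) -> (forall a, D a -> 0 <= g a) ->
  (forall a, D a -> 0 <= k a) -> (forall a, D a -> f a <= g a + k a) ->
  int_pow D f <= (2 `^ p)%:E * (int_pow D g + int_pow D k).
Proof.
move=> mD mf mg mk f0 g0 k0 fgk.
have mgp := measurable_pow mg; have mkp := measurable_pow mk.
rewrite unlock -ge0_integralD//; [|by move=> *; exact: poweR_ge0..].
rewrite -ge0_integralZl_EFin ?powR_ge0//; last 2 first.
- by move=> a _; rewrite adde_ge0 ?poweR_ge0.
- exact: emeasurable_funD.
apply: ge0_le_integral => //.
- by move=> a _; exact: poweR_ge0.
- exact: measurable_pow.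
- by apply: measurable_funeM; exact: emeasurable_funD.
- move=> a Da; apply: le_trans (poweRD_le p1 (g0 _ Da) (k0 _ Da)).
  by apply: le_poweR => //; [exact: f0|exact: fgk].
Qed.

Lemma int_pow_subset A B f : measurable A -> measurable B ->
  measurable_fun B f -> A `<=` B -> int_pow A f <= int_pow B f.
Proof.
move=> mA mB mf AB; rewrite unlock; apply: ge0_subset_integral => //.
  exact: measurable_pow.
by move=> *; exact: poweR_ge0.
Qed.

Lemma int_pow_cst (a b c : R) : (a <= b)%R ->
  int_pow `]a, b] (cst c%:E) = (c `^ p * (b - a))%:E.
Proof.
move=> ab; rewrite unlock (eq_integral (cst (c `^ p)%:E)); last by [].
rewrite integral_cst//= lebesgue_measure_itv/= lte_fin.
case: ltP => [_|ba]; first by rewrite EFinM.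
by rewrite mule0 (_ : b - a = 0)%R ?mulr0//; apply/eqP; rewrite subr_eq0 eq_le ba.
Qed.

Lemma int_pow_cst_le (a b c : R) f : (a <= b)%R ->
  measurable_fun `]a, b] f -> (forall t, t \in `]a, b] -> 0 <= f t) ->
  (forall t, t \in `]a, b] -> f t <= c%:E) ->
  int_pow `]a, b] f <= (c `^ p * (b - a))%:E.
Proof. by move=> ab mf f0 fc; rewrite -int_pow_cst//; exact: le_int_pow. Qed.

Lemma int_pow_split (a b c : R) f : (a <= b <= c)%R -> measurable_fun `]a, c] f ->
  int_pow `]a, c] f = int_pow `]a, b] f + int_pow `]b, c] f.
Proof.
move=> /andP[ab bc] mf.
have E : `]a, c]%classic = `]a, b] `|` `]b, c] :> set R.
  by rewrite -itv_bndbnd_setU// bnd_simp.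
rewrite unlock E ge0_integral_setU//.
- by rewrite -E; exact: measurable_pow.
- by move=> *; exact: poweR_ge0.
- apply/disj_setPS => t [/=]; rewrite !in_itv/= => /andP[_ tb] /andP[bt _].
  by move: (lt_le_trans bt tb); rewrite ltxx.
Qed.

(** Monotone convergence along the intervals [F n]; the denominator [n.+2] keeps their left ends
    strictly between [0] and [s]. *)
Lemma int_pow_oc0_lim (s M : R) f : (0 < s)%R -> measurable_fun `]0%R, s] f ->
  (forall r, (0 < r < s)%R -> int_pow `]r, s] f <= M%:E) ->
  int_pow `]0%R, s] f <= M%:E.
Proof.
move=> s0 mf H.
pose F n := `](s / n.+2%:R)%R, s]%classic.
have Fs n : F n `<=` `]0%R, s].
  move=> t; rewrite /F /= !in_itv/= => /andP[a ->]; rewrite andbT.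
  by rewrite (lt_trans _ a)// divr_gt0.
have FE : \bigcup_n F n = `]0%R, s]%classic.
  apply/seteqP; split; first by apply: bigcup_sub => n _; exact: Fs.
  move=> t /=; rewrite in_itv/= => /andP[t0 ts].
  have [n Hn] : exists n : nat, (s / t < n%:R)%R.
    exists (Num.truncn (s / t)).+1; exact: truncnS_gt.
  exists n => //; rewrite /F/= in_itv/= ts andbT.
  rewrite ltr_pdivrMr// mulrC -ltr_pdivrMr// (lt_le_trans Hn)// ler_nat.
  by rewrite -addn2 leq_addr.
have nd : nondecreasing_seq F.
  move=> i j ij; rewrite subsetEset => t; rewrite /F /= !in_itv/= => /andP[a ->].
  rewrite andbT (le_lt_trans _ a)// ler_pM2l// lef_pV2 ?posrE//.
  by rewrite ler_nat !ltnS.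
have := @ge0_nondecreasing_set_cvg_integral _ (measurableTypeR R) _ F (fun a => (f a) `^ p) mu nd.
move=> /(_ (fun i => measurable_itv _)).
have mF i : measurable_fun (F i) (fun a => f a `^ p).
  by apply: measurable_pow; apply: measurable_funS mf => //; exact: Fs.
move=> /(_ mF (fun i x _ => poweR_ge0 _ _)); rewrite FE => cv.
rewrite unlock -(cvg_lim _ cv)//; apply: lime_le.
  by apply/cvg_ex; eexists; exact: cv.
near=> n; have : (0 < s / n.+2%:R < s)%R.
  by rewrite divr_gt0//= ltr_pdivrMr// ltr_pMr// ltr1n.
by move=> /H; rewrite unlock.
Unshelve. all: by end_near. Qed.

(** By uniqueness of Lebesgue measure it is enough to compare [mu] with its image under the
    translation on half-open intervals. *)
Lemma lebesgue_measure_shift (h : R) (A : set R) : measurable A ->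
  mu ((fun x => x + h)%R @^-1` A) = mu A.
Proof.
move=> mA.
have mphi : measurable_fun [set: measurableTypeR R]
    ((fun x => x + h)%R : measurableTypeR R -> measurableTypeR R).
  by apply: measurable_funD => //; exact: measurable_cst.
pose phi : measurableTypeR R -> measurableTypeR R := (fun x => x + h)%R.
pose nu : {measure set (measurableTypeR R) -> \bar R} := pushforward mu phi.
suff H : forall X, ocitv X -> mu X = nu mphi X.
  by rewrite [RHS](lebesgue_measure_unique H mA).
move=> _ [[a b] /= _ <-]; rewrite /nu /pushforward/=.
rewrite (_ : phi @^-1` _ = `](a - h)%R, (b - h)%R]%classic); last first.
  by apply/seteqP; split=> x /=; rewrite !in_itv/= ltrBlDr lerBrDr.
rewrite !lebesgue_measure_itv/= !lte_fin ltrD2r -!EFinB.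
by case: ifP => // _; congr EFin; ring.
Qed.

Lemma int_pow_shift (h a b : R) f : measurable_fun `](a + h)%R, (b + h)%R] f ->
  int_pow `]a, b] (fun t => f (t + h)%R) = int_pow `](a + h)%R, (b + h)%R] f.
Proof.
move=> mf.
have mphi : measurable_fun [set: measurableTypeR R]
    ((fun x => x + h)%R : measurableTypeR R -> measurableTypeR R).
  by apply: measurable_funD => //; exact: measurable_cst.
have := @ge0_integral_pushforward _ _ _ _ _ _ mphi mu `](a + h)%R, (b + h)%R]
  (fun t => f t `^ p) (measurable_itv _) (measurable_pow mf)
  (fun _ _ => poweR_ge0 _ _).
rewrite (_ : _ @^-1` _ = `]a, b]%classic); last first.
  by apply/seteqP; split=> x /=; rewrite !in_itv/= ltrD2r lerD2r.
rewrite unlock => <-; apply: eq_measure_integral => A mA _.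
by rewrite /= /pushforward lebesgue_measure_shift.
Qed.

End integral_of_powers.

(** * Level cuts *)

Section level_cuts.
Context {R : realType} {m : nat}.
Implicit Types (u v w : 'rV[R]_m -> R) (A B : R -> set 'rV[R]_m).

(** The cut without the special case at level 0, so that antitonicity is transitivity of the
    order. *)
Definition level u (a : R) : set 'rV[R]_m := [set x | a <= u x].

Lemma level_anti u a b : a <= b -> level u b `<=` level u a.
Proof. by move=> ab x; exact: le_trans. Qed.

Lemma level_nonempty u a : normal_fuzzy u -> a <= 1 -> level u a !=set0.
Proof. by move=> [x ux] a1; exists x; rewrite /level/= ux. Qed.

Lemma alpha_cut_level u a : 0 < a -> alpha_cut u a = level u a.
Proof. by move=> a0; rewrite /alpha_cut gt_eqF. Qed.

Lemma level_zero_hat a : 0 < a <= 1 -> level (zero_hat R m) a = [set 0].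
Proof.
move=> /andP[a0 a1]; apply/seteqP; split => x; rewrite /level /zero_hat /= indicE.
  case: (boolP (x \in [set 0])) => [|_]; first by rewrite inE.
  by rewrite leNgt a0.
by move=> ->; rewrite mem_set.
Qed.

Lemma normal_zero_hat : normal_fuzzy (zero_hat R m).
Proof. by exists 0; rewrite /zero_hat indicE mem_set. Qed.

(** By [excess_rat_sup] this is a countable supremum, and each of its terms is a difference of two
    monotone functions of the level. *)
Lemma measurable_excess A B : (forall a, A a !=set0) -> (forall a, B a !=set0) ->
  (forall a b, a <= b -> A b `<=` A a) -> (forall a b, a <= b -> B b `<=` B a) ->
  measurable_fun [set: R] (fun a : R => excess (A a) (B a)).
Proof.
move=> A0 B0 Aanti Banti.
(* Enumerates the rational vectors by their codes; a number that codes nothing yields the zero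
   vector. *)
pose f (k : nat) (a : R) : \bar R :=
  let x := map_mx ratr (odflt 0 (unpickle k : option 'rV[rat]_m)) in
  (point_dist x (B a) - point_dist x (A a))%:E.
rewrite (_ : (fun a => _) = (fun a => esups (f ^~ a) 0)); last first.
  apply/funext => a; rewrite excess_rat_sup//; congr ereal_sup.
  apply/seteqP; split => [_ [q _ <-]|_ [k _ <-]].
    by exists (pickle q) => //; rewrite /f pickleK.
  by exists (odflt 0 (unpickle k)).
apply: measurable_fun_esups => k; apply/measurable_EFinP/measurable_funB.
  apply: nondecreasing_measurable => // a b ab; apply: point_dist_mono => //.
  exact: Banti.
apply: nondecreasing_measurable => // a b ab; apply: point_dist_mono => //.
exact: Aanti.
Qed.

Lemma measurable_hausdorff A B :
  (forall a, A a !=set0) -> (forall a, B a !=set0) ->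
  (forall a b, a <= b -> A b `<=` A a) -> (forall a b, a <= b -> B b `<=` B a) ->
  measurable_fun [set: R] (fun a : R => hausdorff_dist (A a) (B a)).
Proof.
move=> A0 B0 Aanti Banti.
under eq_fun do rewrite hausdorff_distE.
by apply: measurable_maxe; exact: measurable_excess.
Qed.

Lemma measurable_hausdorff_level (D : set R) u v (f g : R -> R) :
  normal_fuzzy u -> normal_fuzzy v ->
  {homo f : a b / a <= b} -> {homo g : a b / a <= b} ->
  (forall a, D a -> f a <= 1) -> (forall a, D a -> g a <= 1) ->
  measurable_fun D (fun a : R => hausdorff_dist (level u (f a)) (level v (g a))).
Proof.
move=> nu nv fm gm f1 g1.
(* Truncating the levels at 1 changes nothing on [D] and keeps all level sets nonempty on the whole
   line. *)
apply: (@eq_measurable_fun _ _ _ _ _ (fun a : R => hausdorff_dist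
    (level u (Num.min (f a) 1)) (level v (Num.min (g a) 1)))).
  by move=> a /set_mem Da; rewrite !min_l ?f1 ?g1.
have min1 (t : R) : Num.min t 1 <= 1 by rewrite ge_min lexx orbT.
have minm (s t : R) : s <= t -> Num.min s 1 <= Num.min t 1.
  by move=> st; rewrite le_min !ge_min lexx st orbT.
apply: measurable_funTS; apply: measurable_hausdorff.
- by move=> a; exact: level_nonempty.
- by move=> a; exact: level_nonempty.
- by move=> a b ab; apply: level_anti; apply/minm/fm.
- by move=> a b ab; apply: level_anti; apply/minm/gm.
Qed.

Definition level_dist u v (a : R) : \bar R :=
  hausdorff_dist (level u a) (level v a).

Definition level_radius u (a : R) : \bar R := hausdorff_dist (level u a) [set 0].

Lemma measurable_level_dist (r s : R) u v : normal_fuzzy u -> normal_fuzzy v ->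
  s <= 1 -> measurable_fun `]r, s] (level_dist u v).
Proof.
by move=> nu nv s1; apply: (@measurable_hausdorff_level _ u v id id) => // a /=;
  rewrite in_itv/= => /andP[_ /le_trans]; exact.
Qed.

Lemma level_radiusE u a : 0 < a <= 1 -> level_radius u a = level_dist u (zero_hat R m) a.
Proof. by move=> a01; rewrite /level_dist level_zero_hat. Qed.

Lemma measurable_level_radius (r s : R) u : normal_fuzzy u ->
  0 <= r -> s <= 1 -> measurable_fun `]r, s] (level_radius u).
Proof.
move=> nu r0 s1.
apply: (@eq_measurable_fun _ _ _ _ _ (level_dist u (zero_hat R m))); last first.
  by apply: measurable_level_dist => //; exact: normal_zero_hat.
move=> a /set_mem/=; rewrite in_itv/= => /andP[ra a1]; rewrite level_radiusE//.
by rewrite (le_lt_trans r0 ra) (le_trans a1).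
Qed.

Lemma level_dist_ge0 u v a : normal_fuzzy u -> a <= 1 -> (0 <= level_dist u v a)%E.
Proof. by move=> nu a1; apply/hausdorff_dist_ge0/level_nonempty. Qed.

Lemma level_radius_ge0 u a : normal_fuzzy u -> a <= 1 -> (0 <= level_radius u a)%E.
Proof. by move=> nu a1; apply/hausdorff_dist_ge0/level_nonempty. Qed.

Lemma level_dist_triangle v u w a :
  normal_fuzzy u -> normal_fuzzy v -> normal_fuzzy w -> a <= 1 ->
  (level_dist u w a <= level_dist u v a + level_dist v w a)%E.
Proof. by move=> *; apply: hausdorff_dist_triangle; exact: level_nonempty. Qed.

Lemma level_dist_radius u v a : normal_fuzzy u -> normal_fuzzy v -> a <= 1 ->
  (level_dist u v a <= level_radius u a + level_radius v a)%E.
Proof.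
move=> nu nv a1; rewrite [X in (_ <= _ + X)%E]/level_radius hausdorff_distC.
by apply: hausdorff_dist_triangle; try exact: level_nonempty; exists 0.
Qed.

Lemma level_distC u v : level_dist u v = level_dist v u.
Proof. by apply/funext => a; rewrite /level_dist hausdorff_distC. Qed.

(** The excess of the singleton over a level is the distance from the origin to that level, hence at
    most the opposite excess; the latter is monotone in the level. *)
Lemma level_radius_anti u a b : normal_fuzzy u -> a <= b -> b <= 1 ->
  (level_radius u b <= level_radius u a)%E.
Proof.
move=> nu ab b1; have H : level_radius u b = excess (level u b) [set 0].
  rewrite /level_radius hausdorff_distE; apply/eqP.
  rewrite eq_le le_max lexx andbT ge_max lexx /=.
  have [x xb] := level_nonempty nu b1.
  apply: (@le_trans _ _ (euclid_dist x 0)%:E).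
    apply: excess_le => _ -> e e0; exists x => //.
    by rewrite euclid_dist_sym lerDl ltW.
  apply: ereal_sup_ubound; exists x => //.
  by rewrite image_set1 ereal_inf1.
by rewrite H; apply: le_trans (excess_le_hausdorff _ _); apply/excess_mono => //;
  exact: level_anti.
Qed.

End level_cuts.

(** * The metric and the three integral conditions in terms of level sets *)

Section dp_as_integral.
Context {R : realType} {m : nat} (p : R).
Hypothesis p1 : 1 <= p.
Implicit Types (u v w : 'rV[R]_m -> R).
Local Open Scope ereal_scope.

(** Level 0, whose cut is a closure, is a null set; at every other level the cut is [level]. *)
Lemma dpE u v : normal_fuzzy u -> normal_fuzzy v ->
  dp p u v = (int_pow p `]0%R, 1%R] (level_dist u v)) `^ p^-1.
Proof.
move=> nu nv; rewrite /dp unlock; congr (_ `^ _).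
rewrite -integral_itv_obnd_cbnd.
  apply: eq_integral => a /set_mem/=; rewrite in_itv/= => /andP[a0 _].
  by rewrite !alpha_cut_level.
apply: measurable_pow; apply: (@eq_measurable_fun _ _ _ _ _ (level_dist u v)); last first.
  exact: measurable_level_dist.
move=> a /set_mem/=; rewrite in_itv/= => /andP[a0 _].
by rewrite !alpha_cut_level.
Qed.

Local Opaque dp.

Lemma dp_lt u v (e : R) : normal_fuzzy u -> normal_fuzzy v -> (0 < e)%R ->
  (dp p u v < e%:E) = (int_pow p `]0%R, 1%R] (level_dist u v) < (e `^ p)%:E).
Proof. by move=> nu nv e0; rewrite dpE// poweRV_lt// int_pow_ge0. Qed.

Lemma dp_sym u v : normal_fuzzy u -> normal_fuzzy v -> dp p u v = dp p v u.
Proof. by move=> nu nv; rewrite !dpE// level_distC. Qed.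

Lemma dp_self u : normal_fuzzy u -> dp p u u = 0.
Proof.
have p0 : (p != 0)%R by rewrite gt_eqF// (lt_le_trans _ p1).
move=> nu; rewrite dpE// unlock integral0_eq ?poweR0r ?invr_eq0// => a /=.
rewrite in_itv/= => /andP[_ a1].
by rewrite /level_dist hausdorff_distxx ?poweR0r//; exact: level_nonempty.
Qed.

Lemma int_pow_level_dist_triangle (r s : R) v u w :
  normal_fuzzy u -> normal_fuzzy v -> normal_fuzzy w -> (s <= 1)%R ->
  int_pow p `]r, s] (level_dist u w) <= (2 `^ p)%:E *
    (int_pow p `]r, s] (level_dist u v) + int_pow p `]r, s] (level_dist v w)).
Proof.
move=> nu nv nw s1; have H a : `]r, s]%classic a -> (a <= 1)%R.
  by rewrite /= in_itv/= => /andP[_ /le_trans]; exact.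
apply: int_powD_le => //; try exact: measurable_level_dist.
- by move=> a /H; exact: level_dist_ge0.
- by move=> a /H; exact: level_dist_ge0.
- by move=> a /H; exact: level_dist_ge0.
- by move=> a /H; exact: level_dist_triangle.
Qed.

(* The constant comes from [2 `^ p * 2 * (e / 4) `^ p <= e `^ p]. *)
Lemma dp_triangle_lt v u w (e : R) : (0 < e)%R ->
  normal_fuzzy u -> normal_fuzzy v -> normal_fuzzy w ->
  dp p u v < (e / 4)%:E -> dp p v w < (e / 4)%:E -> dp p u w < e%:E.
Proof.
move=> e0 nu nv nw; have e4 : (0 < e / 4)%R by rewrite divr_gt0.
move=> uv vw; rewrite (dp_lt nu nw e0).
move: uv; rewrite (dp_lt nu nv e4) => uv.
move: vw; rewrite (dp_lt nv nw e4) => vw.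
apply: le_lt_trans (int_pow_level_dist_triangle 0 nu nv nw (lexx 1)) _.
apply: (@lt_le_trans _ _ ((2 `^ p)%:E * (((e / 4) `^ p)%:E + ((e / 4) `^ p)%:E))).
  rewrite lte_pmul2l// ?lte_fin ?powR_gt0// lteD//.
rewrite -EFinD -EFinM lee_fin.
set d := (e / 4)%R; have d0 : (0 <= d)%R by rewrite divr_ge0// ltW.
rewrite (_ : e = 2 * d * 2)%R; last by rewrite /d; field.
clearbody d; rewrite !powRM ?mulr_ge0// -mulrA ler_pM2l ?powR_gt0//.
rewrite -mulr2n -[(_ *+ 2)%R]mulr_natr ler_wpM2l ?powR_ge0//.
by rewrite -[leLHS]powRr1// ler_powR// ler1n.
Qed.

Lemma dp_zero_hat u : normal_fuzzy u ->
  dp p u (zero_hat R m) = (int_pow p `]0%R, 1%R] (level_radius u)) `^ p^-1.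
Proof.
move=> nu; rewrite dpE//; last exact: normal_zero_hat.
congr (_ `^ _); rewrite unlock; apply: eq_integral => a /set_mem/=; rewrite in_itv/= => a01.
by rewrite level_radiusE.
Qed.

Lemma F_Bp_int_pow u : is_fuzzy u -> normal_fuzzy u -> upper_semicontinuous u ->
  F_Bp R m p u <-> int_pow p `]0%R, 1%R] (level_radius u) < +oo.
Proof.
move=> fu nu su.
have pV0 : (p^-1 != 0)%R by rewrite invr_eq0 gt_eqF// (lt_le_trans _ p1).
have E : \int[lebesgue_measure]_(alpha in `[0%R, 1%R])
       (hausdorff_dist (alpha_cut u alpha) [set 0%R]) `^ p =
    int_pow p `]0%R, 1%R] (level_radius u).
  rewrite unlock -integral_itv_obnd_cbnd.
    apply: eq_integral => a /set_mem/=; rewrite in_itv/= => /andP[a0 _].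
    by rewrite !alpha_cut_level.
  apply: measurable_pow; apply: (@eq_measurable_fun _ _ _ _ _ (level_radius u)); last first.
    exact: measurable_level_radius.
  move=> a /set_mem/=; rewrite in_itv/= => /andP[a0 _].
  by rewrite !alpha_cut_level.
rewrite /F_Bp /= E; split => [[_ _ _]|H]; first exact: lty_poweRy.
by split => //; exact: poweR_lty.
Qed.

(** Off the null set [a = h], both [a] and [a - h] are positive, so both cuts are level sets. *)
Lemma equi_left_integral u (h e : R) : normal_fuzzy u -> (0 <= h)%R -> (0 < e)%R ->
  ((\int[lebesgue_measure]_(alpha in `[h, 1%R])
      (hausdorff_dist (alpha_cut u alpha) (alpha_cut u (alpha - h)%R)) `^ p) `^ p^-1
   < e%:E) =
  (int_pow p `]h, 1%R] (fun a => hausdorff_dist (level u a) (level u (a - h)))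
   < (e `^ p)%:E).
Proof.
move=> nu h0 e0; rewrite -(poweRV_lt p1) ?int_pow_ge0//; congr (_ `^ _ < _).
rewrite unlock -integral_itv_obnd_cbnd.
  apply: eq_integral => a /set_mem/=; rewrite in_itv/= => /andP[a0 _].
  by rewrite !alpha_cut_level// ?subr_gt0// (le_lt_trans h0).
apply: measurable_pow.
apply: (@eq_measurable_fun _ _ _ _ _ (fun a : R =>
    hausdorff_dist (level u a) (level u (a - h)%R))).
- move=> a /set_mem/=; rewrite in_itv/= => /andP[a0 _].
  by rewrite !alpha_cut_level// ?subr_gt0// (le_lt_trans h0).
apply: (measurable_hausdorff_level (f := id)) => //.
- by move=> a b ab; rewrite lerD2r.
- by move=> a /=; rewrite in_itv/= => /andP[].
- by move=> a /=; rewrite in_itv/= lerBlDr => /andP[_ /le_trans]; apply; rewrite lerDl.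
Qed.

End dp_as_integral.

(** * Limits of bounded sets along an ultrafilter *)

Lemma ultrafilter_fmap {T U : Type} (f : T -> U) (F : set_system T) :
  UltraFilter F -> UltraFilter (f @ F).
Proof.
move=> UF; split => [|H PH FH]; first exact: fmap_proper_filter.
apply/seteqP; split=> [A HA|]; last exact: FH.
have [//|FNA] := in_ultra_setVsetC (f @^-1` A) UF.
have HNA : H (~` A) by exact: FH.
by have [x []] := @filter_ex _ H _ _ (filterI HA HNA).
Qed.

Section euclidean_boxes.
Context {R : realType} {m : nat}.

Lemma compact_box (C : R) :
  compact [set v : 'rV[R]_m | forall i, `[- C, C]%classic (v ord0 i)].
Proof.
by apply: (@rV_compact _ _ (fun=> `[- C, C]%classic)) => _; exact: segment_compact.
Qed.

Lemma euclid_dist0_box (x : 'rV[R]_m) (C : R) : euclid_dist x 0 <= C ->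
  forall i, `[- C, C]%classic (x ord0 i).
Proof.
move=> xC j; rewrite /= in_itv/= -ler_norml.
apply: le_trans xC; apply: le_trans (norm_le_euclid_dist x 0).
rewrite subr0 [leRHS]/Num.Def.normr/= mx_normrE.
exact: (le_bigmax _ (fun ij : 'I_1 * 'I_m => `|x ij.1 ij.2|) (ord0, j)).
Qed.

(** Covers the compact box around the ball by interiors of Euclidean balls. *)
Lemma euclid_finite_net (C e : R) : 0 < e -> exists s : seq 'rV[R]_m,
  forall x, euclid_dist x 0 <= C -> exists2 z, z \in s & euclid_dist z x < e.
Proof.
move=> e0; have := @compact_box C; rewrite compact_cover.
move=> /(_ 'rV[R]_m setT (fun z => [set x | euclid_dist z x < e]^°)).
case=> [z _|x _|D _ cov]; first exact: open_interior.
  by exists x => //; exact: euclid_dist_near.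
exists (finmap.enum_fset D) => x /euclid_dist0_box/cov[z /= zD /interior_subset zx].
by exists z.
Qed.

End euclidean_boxes.

Section ultralimit_of_sets.
Context {R : realType} {m : nat} {I : Type} (G : set_system I).
Hypothesis UG : UltraFilter G.
Implicit Types (x y : 'rV[R]_m) (A : I -> set 'rV[R]_m).

(** The Kuratowski limit along [G]. For an ultrafilter the lower and upper limits coincide, since a
    set that meets every member of [G] belongs to [G]. *)
Definition ulim A : set 'rV[R]_m := [set x | forall e : R, 0 < e ->
  G [set i | exists2 y, A i y & euclid_dist x y < e]].

Lemma ultralimit_bounded (f : I -> 'rV[R]_m) (C : R) :
  G [set i | euclid_dist (f i) 0 <= C] ->
  exists x, forall e : R, 0 < e -> G [set i | euclid_dist x (f i) < e].
Proof.
move=> fC.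
have cpt := @compact_box R m C.
rewrite compact_ultra in cpt.
have [|x [_ fx]] := cpt (f @ G) (ultrafilter_fmap f UG).
  exact: (@filterS _ G _ _ _ (fun i => @euclid_dist0_box _ _ (f i) C) fC).
by exists x => e e0; apply: (fx (fun y => euclid_dist x y < e)); exact: euclid_dist_near.
Qed.

(** Closedness of [ulim A], in the form that upper semicontinuity of the limit needs. *)
Lemma ulim_setC_near A x : ~ ulim A x -> \forall y \near x, ~ ulim A y.
Proof.
move=> /existsNP[e /not_implyP[e0 nG]].
have e2 : 0 < e / 2 by rewrite divr_gt0.
apply/euclid_dist_nbhs; exists (e / 2) => // y xy /(_ _ e2) Gy; apply: nG.
apply: filterS Gy => i [z Az yz]; exists z => //.
by rewrite (le_lt_trans (euclid_dist_triangle y _ _))//; lra.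
Qed.

Lemma ulim_approx A (f : I -> 'rV[R]_m) x :
  G [set i | ulim A (f i)] ->
  (forall e : R, 0 < e -> G [set i | euclid_dist x (f i) < e]) -> ulim A x.
Proof.
move=> Gf fx e e0.
have e2 : 0 < e / 2 by rewrite divr_gt0.
have [i [Ki xi]] := @filter_ex _ G _ _ (filterI Gf (fx _ e2)).
apply: filterS (Ki _ e2) => j [z Az yz]; exists z => //.
by have := euclid_dist_triangle (f i) x z; move: xi => /=; lra.
Qed.

Lemma ulim_mono A B : (forall i, A i `<=` B i) -> ulim A `<=` ulim B.
Proof.
move=> AB x Ax e e0; apply: filterS (Ax e e0) => i [y Ay xy]; exists y => //.
exact: AB.
Qed.

Variables (A : I -> set 'rV[R]_m) (C : R).
Hypothesis A0 : G [set i | A i !=set0].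
Hypothesis AC : G [set i | forall x, A i x -> euclid_dist x 0 <= C].

Lemma ulim_nonempty : ulim A !=set0.
Proof.
have pick i : exists y, A i !=set0 -> A i y.
  by have [[y Ay]|] := pselect (A i !=set0); [exists y|exists 0].
have [f fA] := choice pick.
have [|x fx] := @ultralimit_bounded f C.
  by apply: filterS (filterI A0 AC) => i [/fA Af]; apply.
exists x => e e0; apply: filterS (filterI A0 (fx e e0)) => i [/fA Af ?].
by exists (f i).
Qed.

Lemma ulim_bounded x : ulim A x -> euclid_dist x 0 <= C.
Proof.
move=> Kx; apply/ler_addgt0Pr => e e0.
have [i [[y Ay xy] iC]] := @filter_ex _ G _ _ (filterI (Kx e e0) AC).
have := iC y Ay; have := euclid_dist_triangle y x 0; lra.
Qed.

(** Otherwise the bad indices are [G]-large. Points [f i] of [A i] that are [e]-far from [ulim A]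
    then converge along [G], and their limit is a point of [ulim A] closer than [e] to some of
    them. *)
Lemma excess_ulim_right (e : R) : 0 < e ->
  G [set i | (excess (A i) (ulim A) <= e%:E)%E].
Proof.
move=> e0.
have [//|GN] := in_ultra_setVsetC [set i | (excess (A i) (ulim A) <= e%:E)%E] UG.
have far i : exists y, ~ (excess (A i) (ulim A) <= e%:E)%E ->
    A i y /\ forall b, ulim A b -> e < euclid_dist y b.
  have [H|H] := pselect (excess (A i) (ulim A) <= e%:E)%E; first by exists 0.
  have [y Ay yfar] := excess_far H; by exists y.
have [f ff] := choice far.
have [|x fx] := @ultralimit_bounded f C.
  by apply: filterS (filterI GN AC) => i [/ff[Af _]]; apply.
have Kx : ulim A x.
  move=> d d0; apply: filterS (filterI GN (fx d d0)) => i [/ff[Af _] xf].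
  by exists (f i).
have [i [/ff[_ ffar] xf]] := @filter_ex _ G _ _ (filterI GN (fx _ e0)).
have := ffar _ Kx; rewrite euclid_dist_sym => /lt_trans/(_ xf).
by rewrite ltxx.
Qed.

(** Now the far points [f i] lie in [ulim A]. So does their limit [x], by closedness; for some [i]
    it is within [e / 2] both of [f i] and of a point of [A i]. *)
Lemma excess_ulim_left (e : R) : 0 < e ->
  G [set i | (excess (ulim A) (A i) <= e%:E)%E].
Proof.
move=> e0.
have [//|GN] := in_ultra_setVsetC [set i | (excess (ulim A) (A i) <= e%:E)%E] UG.
have far i : exists y, ~ (excess (ulim A) (A i) <= e%:E)%E ->
    ulim A y /\ forall b, A i b -> e < euclid_dist y b.
  have [H|H] := pselect (excess (ulim A) (A i) <= e%:E)%E; first by exists 0.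
  have [y Ay yfar] := excess_far H; by exists y.
have [f ff] := choice far.
have fK : G [set i | ulim A (f i)] by apply: filterS GN => i /ff[].
have [|x fx] := @ultralimit_bounded f C.
  by apply: filterS fK => i; exact: ulim_bounded.
have Kx := ulim_approx fK fx.
have e2 : 0 < e / 2 by rewrite divr_gt0.
have [i [[/ff[_ ffar] xf] [y Ay xy]]] :=
  @filter_ex _ G _ _ (filterI (filterI GN (fx _ e2)) (Kx _ e2)).
have := ffar _ Ay; have := euclid_dist_triangle x (f i) y.
by move: xf; rewrite /= (euclid_dist_sym x (f i)); lra.
Qed.

Lemma hausdorff_ulim (e : R) : 0 < e ->
  G [set i | (hausdorff_dist (A i) (ulim A) <= e%:E)%E].
Proof.
move=> e0; apply: filterS (filterI (excess_ulim_right e0) (excess_ulim_left e0)).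
by move=> i [H1 H2]; rewrite /= hausdorff_distE ge_max H1.
Qed.

End ultralimit_of_sets.

(** * The ultralimit of a family of fuzzy sets *)

Section level_gap.
Context {R : realType} {m : nat} (p : R).
Hypothesis p1 : 1 <= p.
Implicit Types (u v w : 'rV[R]_m -> R).

Definition level_gap u (h a : R) : \bar R :=
  hausdorff_dist (level u a) (level u (a - h)).

Lemma measurable_level_gap (r s h : R) u : normal_fuzzy u -> 0 <= h -> s <= 1 ->
  measurable_fun `]r, s] (level_gap u h).
Proof.
move=> nu h0 s1.
apply: (@measurable_hausdorff_level _ _ _ u u id (fun a => a - h)) => //.
- by move=> a b ab; rewrite lerD2r.
- by move=> a /=; rewrite in_itv/= => /andP[_ /le_trans]; apply.
- move=> a /=; rewrite in_itv/= lerBlDr => /andP[_ /le_trans]; apply.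
  by rewrite (le_trans s1)// lerDl.
Qed.

Lemma measurable_level_gap_shift (r s h : R) u : normal_fuzzy u -> 0 <= h ->
  s + h <= 1 -> measurable_fun `]r, s] (fun a => level_gap u h (a + h)).
Proof.
move=> nu h0 s1; rewrite /level_gap.
apply: (@measurable_hausdorff_level _ _ _ u u (fun a => a + h)
  (fun a => a + h - h)) => //.
- by move=> a b ab; rewrite lerD2r.
- by move=> a b ab; rewrite lerD2r lerD2r.
- move=> a /=; rewrite in_itv/= => /andP[_ ars]; apply: le_trans s1.
  by rewrite lerD2r.
- move=> a /=; rewrite in_itv/= addrK => /andP[_ /le_trans]; apply.
  by apply: le_trans s1; rewrite lerDl.
Qed.

Lemma level_gap_ge0 u h a : normal_fuzzy u -> a <= 1 -> (0 <= level_gap u h a)%E.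
Proof. by move=> nu a1; apply/hausdorff_dist_ge0/level_nonempty. Qed.

(** Translation by [h] carries []r, s]] into []h, 1]]. *)
Lemma int_pow_gap_shift (r s h : R) u : normal_fuzzy u -> 0 <= r -> 0 <= h ->
  s + h <= 1 ->
  (int_pow p `]r, s] (fun a => level_gap u h (a + h)) <=
   int_pow p `]h, 1%R] (level_gap u h))%E.
Proof.
move=> nu r0 h0 s1; rewrite int_pow_shift; last exact: measurable_level_gap.
apply: int_pow_subset => //; first exact: measurable_level_gap.
move=> a /=; rewrite !in_itv/= => /andP[ra a1].
by rewrite (le_trans a1)// andbT (le_lt_trans _ ra)// lerDr.
Qed.

Lemma level_radius_bound u a (C : R) : (level_radius u a <= C%:E)%E ->
  forall x, level u a x -> euclid_dist x 0 <= C.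
Proof.
move=> H x ux; apply/ler_addgt0Pr => e e0; apply/ltW.
by apply: excess_set0_lt ux; rewrite (le_lt_trans H)// lte_fin ltrDl.
Qed.

End level_gap.

Section ultralimit_of_fuzzy_sets.
Context {R : realType} {m : nat} (p : R).
Hypothesis p1 : 1 <= p.
Variable U : set ('rV[R]_m -> R).
Hypothesis Un : forall u, U u -> normal_fuzzy u.
Variable M : R.
Hypothesis UM : forall u, U u -> (int_pow p `]0%R, 1%R] (level_radius u) <= M%:E)%E.
Hypothesis Uelc : forall e : R, 0 < e -> exists2 d : R, 0 < d &
  forall h : R, 0 <= h < d -> forall u, U u ->
    (int_pow p `]h, 1%R] (level_gap u h) <= e%:E)%E.
Implicit Types (u v w : 'rV[R]_m -> R).

Let p_gt0 : 0 < p. Proof. exact: lt_le_trans p1. Qed.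

Let c : R := 2 `^ p.
Let c_gt0 : 0 < c. Proof. by rewrite powR_gt0. Qed.

Lemma uniform_level_radius (a : R) : 0 < a <= 1 ->
  exists2 C : R, 0 <= C & forall u, U u -> (level_radius u a <= C%:E)%E.
Proof.
move=> /andP[a0 a1]; pose C := ((`|M| + 1) / a) `^ p^-1.
exists C; first exact: powR_ge0.
move=> u Uu; rewrite leNgt; apply/negP => Cu.
have nu := Un Uu.
have := UM Uu; apply/negP; rewrite -ltNge.
apply: (@lt_le_trans _ _ (`|M| + 1)%:E); first by rewrite lte_fin; have := ler_norm M; lra.
have -> : `|M| + 1 = C `^ p * (a - 0).
  rewrite /C -powRrM mulVf ?gt_eqF// powRr1 ?subr0 ?divfK ?gt_eqF//.
  by rewrite divr_ge0 ?(ltW a0)// addr_ge0.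
rewrite -int_pow_cst ?(ltW a0)//.
apply: (@le_trans _ _ (int_pow p `]0%R, a] (level_radius u))).
  apply: le_int_pow => //.
  - exact: measurable_level_radius.
  - by move=> t _; rewrite lee_fin powR_ge0.
  - move=> t /=; rewrite in_itv/= => /andP[_ ta]; rewrite (le_trans (ltW Cu))//.
    exact: level_radius_anti.
apply: int_pow_subset => //; first exact: measurable_level_radius.
by move=> t /=; rewrite !in_itv/= => /andP[-> /le_trans]; apply.
Qed.

(* Translating the level by a fixed [h] moves the integral near [0], where radii
   are unbounded, into the region where they are uniformly bounded. *)
Lemma uniform_integrability_at0 (k : R) : 0 < k -> exists2 s : R, 0 < s < 1 &
  forall u, U u -> (int_pow p `]0%R, s] (level_radius u) <= k%:E)%E.
Proof.
move=> k0; have e0 : 0 < k / (2 * c) by rewrite divr_gt0 ?mulr_gt0.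
have [d d0 Hd] := Uelc e0.
(* Below [d] for equi-left-continuity; at most one half, so that [a + h] stays below 1 for all
   [a <= s]. *)
pose h := Num.min (d / 2) 2^-1.
have h0 : 0 < h by rewrite lt_min divr_gt0//= invr_gt0.
have hd : h < d by rewrite /h gt_min; apply/orP; left; lra.
have h2 : h <= 2^-1 by rewrite /h ge_min lexx orbT.
have [C C0 HC] := @uniform_level_radius h (ltac:(by rewrite h0; lra)).
pose s := Num.min 2^-1 (k / (2 * c) / (C `^ p + 1)).
have Cp1 : 0 < C `^ p + 1 by rewrite ltr_wpDl// powR_ge0.
have s0 : 0 < s by rewrite lt_min invr_gt0 ltr0n/= divr_gt0.
have s2 : s <= 2^-1 by rewrite /s ge_min lexx.
exists s => [|u Uu]; first by rewrite s0/=; lra.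
have nu := Un Uu.
have bnd a : 0 <= a <= s -> a + h <= 1 by lra.
have H : (int_pow p `]0%R, s] (level_radius u) <=
   c%:E * (int_pow p `]0%R, s] (fun a => level_gap u h (a + h)) +
           int_pow p `]0%R, s] (cst C%:E)))%E.
  apply: int_powD_le => //.
  - apply: measurable_level_radius => //; lra.
  - apply: measurable_level_gap_shift => //; [exact: ltW|lra].
  - move=> a /=; rewrite in_itv/= => /andP[a0 a1]; apply: level_radius_ge0 => //; lra.
  - move=> a /=; rewrite in_itv/= => /andP[a0 a1]; apply: level_gap_ge0 => //; lra.
  - move=> a /=; rewrite in_itv/= => /andP[a0 a1].
    apply: (@le_trans _ _ (level_gap u h (a + h) + level_radius u (a + h))%E).
      rewrite /level_gap addrK hausdorff_distC; apply: hausdorff_dist_triangle.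
      + by apply: level_nonempty => //; lra.
      + by apply: level_nonempty => //; lra.
      + by exists 0.
    apply: leeD2l; apply: le_trans (HC _ Uu).
    by apply: level_radius_anti => //; lra.
apply: (le_trans H).
have H1 : (int_pow p `]0%R, s] (fun a => level_gap u h (a + h)) <= (k / (2 * c))%:E)%E.
  apply: le_trans (int_pow_gap_shift _ nu (lexx 0) (ltW h0) _) _ => //; first lra.
  by apply: Hd => //; rewrite (ltW h0).
have H2 : (int_pow p `]0%R, s] (cst C%:E) <= (k / (2 * c))%:E)%E.
  rewrite int_pow_cst ?(ltW s0)// subr0 lee_fin.
  apply: (@le_trans _ _ ((C `^ p + 1) * s)); first by rewrite ler_wpM2r ?(ltW s0)// lerDl.
  by rewrite mulrC -ler_pdivlMr// /s ge_min lexx orbT.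
apply: (@le_trans _ _ (c%:E * ((k / (2 * c))%:E + (k / (2 * c))%:E))%E).
  by rewrite lee_pmul2l// ?lte_fin// leeD.
rewrite -EFinD -EFinM lee_fin le_eqVlt; apply/orP; left; apply/eqP.
by field; rewrite gt_eqF.
Qed.

Variable G : set_system ('rV[R]_m -> R).
Hypothesis UG : UltraFilter G.
Hypothesis GU : G U.

Definition limit_level (a : R) : set 'rV[R]_m := ulim G (fun u => level u a).

(** Adjoining [0] keeps the set nonempty at points that lie in no limit level. *)
Definition limit_fuzzy (x : 'rV[R]_m) : R :=
  sup ([set 0] `|` [set a | 0 < a <= 1 /\ limit_level a x]).

Local Notation K := limit_level.
Local Notation w := limit_fuzzy.

Lemma limit_level_anti a b : a <= b -> K b `<=` K a.
Proof. by move=> ab; apply: ulim_mono => u; exact: level_anti. Qed.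

Lemma limit_level_has_sup x :
  has_sup ([set 0] `|` [set a | 0 < a <= 1 /\ K a x]).
Proof.
by split; [exists 0; left|exists 1 => a [->//|[/andP[_ a1] _]]].
Qed.

Lemma limit_fuzzy_ge a x : 0 < a <= 1 -> K a x -> a <= w x.
Proof.
by move=> a01 Kax; apply: sup_upper_bound; [exact: limit_level_has_sup|right].
Qed.

Lemma limit_fuzzy_gt b x : 0 < b -> b < w x -> K b x.
Proof.
move=> b0 bw; have e0 : 0 < w x - b by rewrite subr_gt0.
have [a [->|[a01 Ka]]] := sup_adherent e0 (limit_level_has_sup x).
  by rewrite -/(w x); lra.
rewrite -/(w x) => ab; apply: limit_level_anti Ka; lra.
Qed.

Lemma is_fuzzy_limit : is_fuzzy w.
Proof.
move=> x; apply/andP; split.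
  by apply: sup_upper_bound; [exact: limit_level_has_sup|left].
by apply: ge_sup => [|a [->//|[/andP[_ a1] _]]//]; exists 0; left.
Qed.

Lemma levels_eventually_nonempty a : a <= 1 -> G [set u | level u a !=set0].
Proof. by move=> a1; apply: filterS GU => u /Un nu; exact: level_nonempty. Qed.

Lemma levels_eventually_bounded a : 0 < a <= 1 -> exists2 C : R, 0 <= C &
  G [set u | forall x, level u a x -> euclid_dist x 0 <= C].
Proof.
move=> /uniform_level_radius[C C0 HC]; exists C => //.
apply: filterS GU => u /HC; exact: level_radius_bound.
Qed.

Lemma normal_limit : normal_fuzzy w.
Proof.
have a01 : 0 < (1 : R) <= 1 by rewrite ltr01 lexx.
have [C _ HC] := levels_eventually_bounded a01.
have [x Kx] := ulim_nonempty UG (levels_eventually_nonempty (lexx 1)) HC.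
exists x; apply/eqP; rewrite eq_le limit_fuzzy_ge// andbT.
by case/andP: (is_fuzzy_limit x).
Qed.

Lemma usc_limit : upper_semicontinuous w.
Proof.
move=> x a wxa; have /andP[w0 w1] := is_fuzzy_limit x.
have [a1|a1] := ltP 1 a.
  by near=> y; have /andP[_ /le_lt_trans] := is_fuzzy_limit y; apply.
(* Above [w x], so [x] misses the closed set [K b], and so do nearby points; below [a], so
   [a <= w y] would put [y] in [K b]. *)
pose b := (w x + a) / 2.
have b1 : 0 < b <= 1 by rewrite /b; lra.
have nKx : ~ K b x by move=> /(limit_fuzzy_ge b1); rewrite /b; lra.
near=> y.
have nKy : ~ K b y by near: y; exact: ulim_setC_near.
rewrite ltNge; apply/negP => ay; apply: nKy.
by apply: limit_fuzzy_gt; move: b1; rewrite /b; lra.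
Unshelve. all: by end_near. Qed.

Lemma limit_level_sub a : 0 < a <= 1 -> K a `<=` level w a.
Proof. by move=> a01 x; exact: limit_fuzzy_ge. Qed.

Lemma level_limit_sub a b : 0 < b < a -> level w a `<=` K b.
Proof.
by move=> /andP[b0 ba] x aw; apply: limit_fuzzy_gt => //; exact: lt_le_trans aw.
Qed.

(** For grid points [t < a <= b] within [h] of [a]: [level u a] is compared with [K b], which lies
    inside [level w a], by way of [level u b]; and [level w a], which lies inside [K t], with
    [level u a] by way of [level u t]. *)
Lemma level_limit_dist_le u (h t b a eta : R) : normal_fuzzy u ->
  0 < t < a -> a <= b -> a - h <= t -> b <= a + h -> 0 < a -> a + h <= 1 ->
  (hausdorff_dist (level u t) (K t) <= eta%:E)%E ->
  (hausdorff_dist (level u b) (K b) <= eta%:E)%E ->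
  (level_dist u w a <= eta%:E + (level_gap u h a + level_gap u h (a + h)))%E.
Proof.
move=> nu ta ab aht bah a0 ah1 Ht Hb.
have gap0 : (0 <= level_gap u h a)%E by apply: level_gap_ge0 => //; lra.
have gap1 : (0 <= level_gap u h (a + h))%E by exact: level_gap_ge0.
have ne s : s <= 1 -> level u s !=set0 by exact: level_nonempty.
have K0 s : 0 < s <= 1 -> K s !=set0.
  move=> s01; have [C _ HC] := levels_eventually_bounded s01.
  apply: ulim_nonempty HC => //; apply: levels_eventually_nonempty; lra.
rewrite [leLHS]hausdorff_distE ge_max; apply/andP; split.
  apply: (@le_trans _ _ (excess (level u a) (K b))).
    apply: excess_mono => //; apply: (subset_trans (limit_level_anti ab)).
    by apply: limit_level_sub; lra.
  apply: le_trans (excess_triangle _ _ (ne b _)) _; [apply: ne; lra|lra|].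
  rewrite addeC; apply: leeD; first exact: le_trans (excess_le_hausdorff _ _) Hb.
  apply: (@le_trans _ _ (level_gap u h (a + h))); last by rewrite leeDr.
  rewrite /level_gap addrK; apply: le_trans (excess_le_hausdorffC _ _).
  by apply: excess_mono => //; exact: level_anti.
apply: (@le_trans _ _ (excess (K t) (level u a))).
  by apply: excess_mono => //; exact: level_limit_sub.
apply: le_trans (excess_triangle _ _ (ne t _)) _; [apply: K0; lra|lra|].
apply: leeD; first exact: le_trans (excess_le_hausdorffC _ _) Ht.
apply: (@le_trans _ _ (level_gap u h a)); last by rewrite leeDl.
apply: le_trans (excess_le_hausdorffC _ _).
by apply: excess_mono => //; exact: level_anti.
Qed.

(** The lower bound is strict because [level w a] is known to lie in [K t] only for [t < a]. *)
Lemma ceil_nat (x : R) : 0 < x -> exists2 k : nat, k%:R < x & x <= k.+1%:R.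
Proof.
move=> x0; have ex : exists n : nat, x <= n%:R.
  by exists (Num.truncn x).+1; apply/ltW/truncnS_gt.
case: (ex_minnP ex) => -[|n] xn nmin; first by move: x0; rewrite ltNge xn.
exists n => //; rewrite ltNge; apply/negP => /nmin.
by rewrite ltnn.
Qed.

(** On a finite grid, closeness to the limit levels holds at all grid points simultaneously for
    [G]-many [u]. This controls []r, 1 - h]]; the strip above [1 - h], where [a + h] exceeds 1, is
    short and radii are bounded there. *)
Lemma tail_limit (r t : R) : 0 < r < 1 -> 0 < t ->
  G [set u | (int_pow p `]r, 1%R] (level_dist u w) <= t%:E)%E].
Proof.
move=> r01 t0.
have [C C0 HC] := @uniform_level_radius 2^-1 (ltac:(by rewrite invr_gt0; lra)).
have e0 : 0 < t / (8 * c * c) by rewrite divr_gt0 ?mulr_gt0.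
have [d d0 Hd] := Uelc e0.
pose B := (2 * C) `^ p.
have B0 : 0 <= B by exact: powR_ge0.
(* The mesh [h] is an inverse integer, so the grid ends exactly at 1. The four bounds serve
   equi-left-continuity, a grid point below every [a > r], the radius bound at level one half, and
   the strip near 1. *)
have [n] : exists n : nat, n.+1%:R^-1 <
    Num.min (Num.min d r) (Num.min 2^-1 (t / 4 / (B + 1))).
  have : 0 < Num.min (Num.min d r) (Num.min 2^-1 (t / 4 / (B + 1))).
    rewrite !lt_min d0 invr_gt0 ltr0n/= !divr_gt0//; last by rewrite ltr_wpDl.
    by case/andP: r01 => ->.
  set x := Num.min _ _ => x0; exists (Num.truncn x^-1).
  by rewrite invf_plt ?posrE//; exact: truncnS_gt.
set h := n.+1%:R^-1; rewrite !lt_min => /andP[/andP[hd hr] /andP[h2 hB]].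
have h0 : 0 < h by rewrite invr_gt0.
have Bh : B * h <= t / 4.
  apply: (@le_trans _ _ ((B + 1) * h)); first by rewrite ler_wpM2r ?(ltW h0)// lerDl.
  by rewrite mulrC -ler_pdivlMr ?(ltW hB)// ltr_wpDl.
(* With [t / (8 * c * c)] for each gap integral, two uses of the quasi-triangle inequality give
   [t / 2], within the [3 / 4 * t] left by the last strip. *)
pose eta := (t / (4 * c)) `^ p^-1.
have tc0 : 0 < t / (4 * c) by rewrite divr_gt0 ?mulr_gt0.
have eta0 : 0 < eta by rewrite powR_gt0.
have etap : eta `^ p = t / (4 * c).
  by rewrite /eta -powRrM mulVf ?gt_eqF// powRr1// ltW.
have Hgrid : G [set u | forall j : 'I_n.+1,
    (hausdorff_dist (level u (j.+1%:R * h)) (K (j.+1%:R * h)) <= eta%:E)%E].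
  apply: filter_forall => j.
  have jh : 0 < j.+1%:R * h <= 1.
    by rewrite mulr_gt0//= ler_pdivrMr// mul1r ler_nat.
  have [D _ HD] := levels_eventually_bounded jh.
  exact: (hausdorff_ulim UG HD eta0).
apply: filterS (filterI Hgrid GU) => u [/= grid Uu].
have nu := Un Uu; have nw := normal_limit.
have r1h : r <= 1 - h \/ 1 - h < r by case: (leP r (1 - h)); [left|right].
have Hlast s : 1 - h <= s <= 1 -> (int_pow p `]s, 1%R] (level_dist u w) <= (t / 4)%:E)%E.
  move=> /andP[hs s1].
  apply: (@le_trans _ _ (B * (1 - s))%:E).
    apply: int_pow_cst_le => //.
    - exact: measurable_level_dist.
    - by move=> a; rewrite in_itv/= => /andP[_ a1]; exact: level_dist_ge0.
    - move=> a; rewrite in_itv/= => /andP[sa a1].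
      apply: (le_trans (level_dist_radius nu nw a1)).
      rewrite mulr_natl mulr2n EFinD; apply: leeD.
        apply: le_trans (HC _ Uu); apply: level_radius_anti => //; lra.
      apply: hausdorff_dist_set0_le; first exact: level_nonempty.
      move=> x /(@level_limit_sub a 2^-1 (ltac:(by rewrite invr_gt0; lra))).
      apply: ulim_bounded; apply: filterS GU => v /HC; exact: level_radius_bound.
  rewrite lee_fin; apply: le_trans Bh; apply: ler_wpM2l => //; lra.
have [{}r1h|{}r1h] := r1h; last first.
  by apply: le_trans (Hlast r _) _; [lra|rewrite lee_fin; lra].
rewrite (@int_pow_split _ p r (1 - h) 1); [|by rewrite r1h/=; lra|exact: measurable_level_dist].
rewrite (_ : t = 3 / 4 * t + t / 4); last by field.
rewrite EFinD; apply: leeD; last by apply: Hlast; lra.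
have mg s : s <= 1 -> measurable_fun `]r, s] (level_gap u h).
  by move=> s1; apply: measurable_level_gap => //; exact: ltW.
have mg' : measurable_fun `]r, (1 - h)] (fun a => level_gap u h (a + h)).
  by apply: measurable_level_gap_shift; [|exact: ltW|lra].
have g0 a : `]r, (1 - h)]%classic a -> (0 <= level_gap u h a)%E.
  by rewrite /= in_itv/= => /andP[_ a1]; apply: level_gap_ge0 => //; lra.
have g0' a : `]r, (1 - h)]%classic a -> (0 <= level_gap u h (a + h))%E.
  by rewrite /= in_itv/= => /andP[_ a1]; apply: level_gap_ge0 => //; lra.
have H1 : (int_pow p `]r, (1 - h)%R] (level_dist u w) <=
   c%:E * (int_pow p `]r, (1 - h)%R] (cst eta%:E) +
           int_pow p `]r, (1 - h)%R] (fun a => level_gap u h a + level_gap u h (a + h))))%E.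
  apply: int_powD_le => //.
  - apply: measurable_level_dist => //; lra.
  - by apply: emeasurable_funD => //; apply: mg; lra.
  - by move=> a /=; rewrite in_itv/= => /andP[_ a1]; apply: level_dist_ge0 => //; lra.
  - by move=> a _; rewrite lee_fin ltW.
  - by move=> a Da; apply: adde_ge0; [exact: g0|exact: g0'].
  - move=> a /=; rewrite in_itv/= => /andP[ra a1].
    have a0 : 0 < a by lra.
    (* The grid points around [a] are [k * h] and [k.+1 * h]. Index [j] of the grid stands for level
       [j.+1 * h], so they have indices [k.-1] and [k]; [k] is positive because [h < r < a]. *)
    have [k ka ak] := @ceil_nat (a / h) (divr_gt0 a0 h0).
    move: ka ak; rewrite ltr_pdivlMr// ler_pdivrMr// => ka ak.
    have k0 : (0 < k)%N.
      by case: k ka ak => // _; rewrite mul1r; lra.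
    have k1 : (k < n.+1)%N.
      rewrite -(ltr_nat R) -[n.+1%:R]invrK -/h -[ltRHS]div1r ltr_pdivlMr//; lra.
    have k2 : (k.-1 < n.+1)%N by rewrite (leq_ltn_trans (leq_pred _)).
    apply: (@level_limit_dist_le u h (k%:R * h) (k.+1%:R * h)) => //.
    + by rewrite mulr_gt0 ?ltr0n.
    + by move: ak; rewrite -natr1 mulrDl mul1r; lra.
    + by rewrite -natr1 mulrDl mul1r; lra.
    + lra.
    + by have := grid (Ordinal k2); rewrite /= prednK.
    + exact: grid (Ordinal k1).
apply: (le_trans H1).
have H2 : (int_pow p `]r, (1 - h)%R] (fun a => level_gap u h a + level_gap u h (a + h)) <=
   c%:E * (int_pow p `]r, (1 - h)%R] (level_gap u h) +
           int_pow p `]r, (1 - h)%R] (fun a => level_gap u h (a + h))))%E.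
  apply: int_powD_le => //.
  - by apply: emeasurable_funD => //; apply: mg; lra.
  - by apply: mg; lra.
  - by move=> a Da; apply: adde_ge0; [exact: g0|exact: g0'].
have H3 : (int_pow p `]r, (1 - h)%R] (level_gap u h) <= (t / (8 * c * c))%:E)%E.
  apply: le_trans (Hd h _ _ Uu); last by rewrite (ltW h0).
  apply: int_pow_subset => //; first by apply: measurable_level_gap => //; exact: ltW.
  by move=> a /=; rewrite !in_itv/=; lra.
have H4 : (int_pow p `]r, (1 - h)%R] (fun a => level_gap u h (a + h)) <=
    (t / (8 * c * c))%:E)%E.
  apply: le_trans (Hd h _ _ Uu); last by rewrite (ltW h0).
  by apply: int_pow_gap_shift => //; lra.
have H5 : (int_pow p `]r, (1 - h)%R] (cst eta%:E) <= (t / (4 * c))%:E)%E.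
  by rewrite int_pow_cst// etap lee_fin ler_piMr ?(ltW tc0)//; lra.
apply: (@le_trans _ _ (c%:E * ((t / (4 * c))%:E + c%:E *
    ((t / (8 * c * c))%:E + (t / (8 * c * c))%:E)))%E).
  rewrite lee_pmul2l ?lte_fin//; apply: leeD => //; apply: (le_trans H2).
  by rewrite lee_pmul2l ?lte_fin//; apply: leeD.
rewrite -!(EFinD, EFinM) lee_fin.
rewrite (_ : c * _ = t / 2); first lra.
by field; rewrite gt_eqF.
Qed.

(** Near level 0 nothing is known yet about the radii of [w]. On []r, s]] it is therefore compared
    with some [v] in [U] that is close to it on []r, 1]], and [u] with [v] by their small radii. The
    bound does not depend on [r], which then tends to 0. *)
Lemma limit_dist (e : R) : 0 < e ->
  G [set u | (int_pow p `]0%R, 1%R] (level_dist u w) <= e%:E)%E].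
Proof.
(* Chosen so that [c * (c * (k + k) + k) = e / 2]. *)
move=> e0; pose k := e / 2 / (2 * c * c + c).
have cc : 0 < 2 * c * c + c by rewrite addr_gt0// !mulr_gt0.
have k0 : 0 < k by rewrite !divr_gt0.
have [s s01 Hs] := uniform_integrability_at0 k0.
have e2 : 0 < e / 2 by rewrite divr_gt0.
have nw := normal_limit.
apply: filterS (filterI (tail_limit s01 e2) GU) => u [/= tl Uu].
have nu := Un Uu; case/andP: s01 => s0 s1.
rewrite (@int_pow_split _ p 0 s 1); [|by rewrite !ltW|exact: measurable_level_dist].
rewrite (_ : e = e / 2 + e / 2); last by field.
rewrite EFinD; apply: leeD => //.
apply: int_pow_oc0_lim => //; first by apply: measurable_level_dist => //; exact: ltW.
move=> r /andP[r0 rs].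
have r01 : 0 < r < 1 by rewrite r0 (lt_trans rs).
have [v [/= vw Uv]] := @filter_ex _ G _ _ (filterI (tail_limit r01 k0) GU).
have nv := Un Uv.
apply: le_trans (int_pow_level_dist_triangle p1 r nu nv nw (ltW s1)) _; rewrite -/c.
have radius_le u' : U u' -> (int_pow p `]r, s] (level_radius u') <= k%:E)%E.
  move=> Uu'; apply: le_trans (Hs _ Uu'); apply: int_pow_subset => //.
    by apply: measurable_level_radius => //; [exact: Un|exact: ltW].
  by move=> a /=; rewrite !in_itv/= => /andP[ra ->]; rewrite (lt_trans r0 ra).
have H1 : (int_pow p `]r, s] (level_dist u v) <= c%:E * (int_pow p `]r, s] (level_radius u)
    + int_pow p `]r, s] (level_radius v)))%E.
  have a1 a : `]r, s]%classic a -> a <= 1.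
    by rewrite /= in_itv/= => /andP[_ /le_trans]; apply; exact: ltW.
  apply: int_powD_le => //.
  - by apply: measurable_level_dist => //; exact: ltW.
  - by apply: measurable_level_radius => //; exact: ltW.
  - by apply: measurable_level_radius => //; exact: ltW.
  - by move=> a /a1; exact: level_dist_ge0.
  - by move=> a /a1; exact: level_radius_ge0.
  - by move=> a /a1; exact: level_radius_ge0.
  - by move=> a /a1; exact: level_dist_radius.
have H2 : (int_pow p `]r, s] (level_dist v w) <= k%:E)%E.
  apply: le_trans vw; apply: int_pow_subset => //; first exact: measurable_level_dist.
  by move=> a /=; rewrite !in_itv/= => /andP[-> as_]; rewrite (le_trans as_)// ltW.
apply: (@le_trans _ _ (c%:E * (c%:E * (k%:E + k%:E) + k%:E))%E).
  rewrite lee_pmul2l ?lte_fin//; apply: leeD => //; apply: (le_trans H1).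
  by rewrite lee_pmul2l ?lte_fin//; apply: leeD; exact: radius_le.
rewrite -!(EFinD, EFinM) lee_fin le_eqVlt; apply/orP; left; apply/eqP.
by rewrite /k; field; rewrite gt_eqF.
Qed.

Lemma F_Bp_limit : F_Bp R m p w.
Proof.
have nw := normal_limit.
apply/F_Bp_int_pow => //; [exact: is_fuzzy_limit|exact: usc_limit|].
have [u [/= uw Uu]] := @filter_ex _ G _ _ (filterI (limit_dist ltr01) GU).
have nu := Un Uu.
apply: (@le_lt_trans _ _ (c%:E * (int_pow p `]0%R, 1%R] (level_dist u w) +
    int_pow p `]0%R, 1%R] (level_radius u)))%E).
  have a1 a : `]0, 1]%classic a -> a <= 1 :> R by rewrite /= in_itv/= => /andP[].
  apply: int_powD_le => //.
  - exact: measurable_level_radius.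
  - exact: measurable_level_dist.
  - exact: measurable_level_radius.
  - by move=> a /a1; exact: level_radius_ge0.
  - by move=> a /a1; exact: level_dist_ge0.
  - by move=> a /a1; exact: level_radius_ge0.
  - move=> a /a1 le_a1; rewrite level_distC; apply: hausdorff_dist_triangle.
    + exact: level_nonempty.
    + exact: level_nonempty.
    + by exists 0.
apply: (@le_lt_trans _ _ (c%:E * (1%:E + M%:E))%E); last by rewrite -EFinD -EFinM ltry.
by rewrite lee_pmul2l ?lte_fin//; apply: leeD => //; exact: UM.
Qed.

End ultralimit_of_fuzzy_sets.

(** * Fuzzy sets with bounded support *)

Section exceptional_intervals.
Context {R : realType} (p : R).
Hypothesis p1 : 1 <= p.
Local Open Scope ereal_scope.
Local Notation mu := (@lebesgue_measure R).

(** The p-th power of [f] is dominated by the constant [e]^ p[plus]B [^ p] times the indicators of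
    the exceptional intervals. *)
Lemma int_pow_exceptional (T : eqType) (a b e B l : R) (s : seq T) (J : T -> R)
    (f : R -> \bar R) :
  (a <= b)%R -> (0 <= e)%R -> (0 <= B)%R -> (0 <= l)%R ->
  measurable_fun `]a, b] f -> (forall t, t \in `]a, b] -> 0 <= f t) ->
  (forall t, t \in `]a, b] -> f t <= e%:E \/
     f t <= B%:E /\ exists2 z, z \in s & (J z <= t <= J z + l)%R) ->
  int_pow p `]a, b] f <= (e `^ p * (b - a) + (size s)%:R * (B `^ p * l))%:E.
Proof.
move=> ab e0 B0 l0 mf f0 H.
pose I z := `[J z, (J z + l)%R]%classic.
have measIz z : measurable (I z : set (measurableTypeR R)) by exact: measurable_itv.
have mI z : measurable_fun `]a, b] (fun t : R => (B `^ p * \1_(I z) t)%:E).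
  by apply/measurable_EFinP; apply: measurable_funM => //; apply: measurable_indic; exact: measIz.
have I0 z (t : R) : 0 <= (B `^ p * \1_(I z) t)%:E.
  by rewrite lee_fin mulr_ge0 ?powR_ge0.
have mS := emeasurable_sum s mI.
have sum0 t : 0 <= \sum_(z <- s) (B `^ p * \1_(I z) t)%:E.
  by apply: sume_ge0 => z _; exact: I0.
apply: (@le_trans _ _ (\int[mu]_(t in `]a, b])
    (cst (e `^ p)%:E t + \sum_(z <- s) (B `^ p * \1_(I z) t)%:E))).
  rewrite unlock; apply: ge0_le_integral => //.
  - by move=> t _; exact: poweR_ge0.
  - exact: measurable_pow.
  - by apply: emeasurable_funD => //; exact: measurable_cst.
  - move=> t /= tab; have ft := f0 _ tab; have [fe|[fB [z zs zt]]] := H _ tab.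
      apply: (@le_trans _ _ (e `^ p)%:E); last by rewrite leeDl.
      by rewrite -poweR_EFin; exact: le_poweR.
    apply: (@le_trans _ _ (B `^ p)%:E); first by rewrite -poweR_EFin; exact: le_poweR.
    rewrite (big_rem z)//= indicE mem_set; last by rewrite /I /= in_itv.
    rewrite mulr1 addeCA leeDl// adde_ge0 ?lee_fin ?powR_ge0//.
    by apply: sume_ge0 => y _; exact: I0.
rewrite ge0_integralD//; last first.
- by move=> t _; rewrite lee_fin powR_ge0.
have -> : \int[mu]_(t in `]a, b]) cst (e `^ p)%:E t = (e `^ p * (b - a))%:E.
  by rewrite -int_pow_cst// unlock.
rewrite EFinD leeD2l// ge0_integral_sum//.
apply: (@le_trans _ _ (\sum_(z <- s) (B `^ p * l)%:E)); last first.
  by rewrite sumEFin lee_fin big_const_seq count_predT iter_addr_0 mulr_natl.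
apply: lee_sum => z _.
under eq_integral do rewrite EFinM.
rewrite ge0_integralZl_EFin ?powR_ge0//; last first.
  by apply/measurable_EFinP; apply: measurable_indic; exact: measIz.
rewrite (integral_indic _ _ (measIz z))// EFinM lee_wpmul2l ?lee_fin ?powR_ge0//.
apply: (@le_trans _ _ (mu (I z))).
  apply: le_measure; last exact: subIsetl.
    by apply/mem_set; apply: measurableI; [exact: measIz|exact: measurable_itv].
  by apply/mem_set; exact: measIz.
rewrite /I lebesgue_measure_itv/= lte_fin.
by case: ifP => _; rewrite lee_fin// addrC addKr.
Qed.

End exceptional_intervals.

Section bounded_fuzzy_sets.
Context {R : realType} {m : nat} (p : R).
Hypothesis p1 : 1 <= p.
Implicit Types (u v w : 'rV[R]_m -> R).

Lemma F_B_level_radius u : F_B R m u -> exists2 C : R, 0 <= C &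
  forall a, 0 < a <= 1 -> (level_radius u a <= C%:E)%E.
Proof.
move=> [fu nu _ [M [Mreal HM]]]; exists (m%:R * (`|M| + 1)).
  by rewrite mulr_ge0// addr_ge0.
move=> a /andP[a0 a1]; apply: hausdorff_dist_set0_le; first exact: level_nonempty.
move=> x ax; apply: (le_trans (euclid_dist_le_norm _ _)).
rewrite ler_wpM2l// subr0; apply: HM.
  by rewrite (le_lt_trans (ler_norm M))// ltrDl.
rewrite /alpha_cut eqxx; apply: subset_closure => /=.
exact: lt_le_trans ax.
Qed.

Lemma F_B_sub_F_Bp u : F_B R m u -> F_Bp R m p u.
Proof.
move=> Fu; have [fu nu su _] := Fu; apply/F_Bp_int_pow => //.
have [C C0 HC] := F_B_level_radius Fu.
apply: (@le_lt_trans _ _ (C `^ p * (1 - 0))%:E); last exact: ltry.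
apply: int_pow_cst_le => //; first exact: measurable_level_radius.
by move=> t; rewrite in_itv/= => /andP[_ t1]; exact: level_radius_ge0.
Qed.

(* If the gap at [a] exceeds [d], some point [x] of [level u (a - h)] is [d]-far
   from [level u a]; on the [d/2]-ball of the net around [x] the supremum of [u]
   lies in [[a - h, a]], so [a] lies in one of finitely many intervals of length
   [h]. *)
Lemma F_B_equi_left_continuous u : F_B R m u -> forall e : R, 0 < e ->
  exists2 d : R, 0 < d & forall h : R, 0 <= h < d ->
    (int_pow p `]h, 1%R] (level_gap u h) <= e%:E)%E.
Proof.
move=> Fu e e0; have [fu nu su _] := Fu.
have p0 : 0 < p by exact: lt_le_trans p1.
have [C C0 HC] := F_B_level_radius Fu.
pose d := (e / 2) `^ p^-1.
have d0 : 0 < d by apply: powR_gt0; rewrite divr_gt0.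
have dp : d `^ p = e / 2.
  by rewrite /d -powRrM mulVf ?gt_eqF// powRr1// divr_ge0// ltW.
have d2 : 0 < d / 2 by rewrite divr_gt0.
have [s Hs] := @euclid_finite_net R m C _ d2.
pose S z := [set u y | y in [set y | euclid_dist z y < d / 2]].
have supS z y : euclid_dist z y < d / 2 -> u y <= sup (S z).
  move=> zy; apply: sup_upper_bound; last by exists y.
  split; first by exists (u y), y.
  by exists 1 => _ [y' _ <-]; case/andP: (fu y').
pose Q := (size s)%:R * (2 * C) `^ p.
have Q0 : 0 <= Q by rewrite mulr_ge0// powR_ge0.
exists (Num.min 1 (e / 2 / (Q + 1))).
  by rewrite lt_min ltr01/= divr_gt0 ?divr_gt0// ltr_wpDl.
move=> h; rewrite lt_min => /andP[h0 /andP[h1 hQ]].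
have Qh : Q * h <= e / 2.
  apply: (@le_trans _ _ ((Q + 1) * h)); first by rewrite ler_wpM2r// lerDl.
  by rewrite mulrC -ler_pdivlMr ?(ltW hQ)// ltr_wpDl.
apply: (@le_trans _ _ (d `^ p * (1 - h) + (size s)%:R * ((2 * C) `^ p * h))%:E); last first.
  rewrite lee_fin mulrA -/Q dp.
  have : e / 2 * (1 - h) <= e / 2 by rewrite ler_piMr//; lra.
  lra.
apply: (@int_pow_exceptional _ p p1 _ h 1 d (2 * C) h s (fun z => sup (S z) )) => //.
- exact: ltW.
- exact: ltW.
- by rewrite mulr_ge0.
- exact: measurable_level_gap.
- by move=> a; rewrite in_itv/= => /andP[_ a1]; exact: level_gap_ge0.
move=> a; rewrite in_itv/= => /andP[ha a1].
have [near|/excess_far[x ax xfar]] :=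
  pselect (excess (level u (a - h)) (level u a) <= d%:E)%E.
  left; rewrite /level_gap hausdorff_distE ge_max near andbT.
  apply: (@le_trans _ _ 0%E); last by rewrite lee_fin ltW.
  by apply/excess_sub/level_anti; lra.
right; split.
  rewrite mulr_natl mulr2n EFinD.
  apply: (@le_trans _ _ (level_radius u a + level_radius u (a - h))%E).
    rewrite [X in (_ <= _ + X)%E]/level_radius hausdorff_distC.
    apply: hausdorff_dist_triangle; last by apply: level_nonempty => //; lra.
      exact: level_nonempty.
    by exists 0.
  by apply: leeD; apply: HC; lra.
have xC : euclid_dist x 0 <= C by apply: level_radius_bound ax; apply: HC; lra.
have [z zs zx] := Hs x xC; exists z => //; apply/andP; split.
  apply: ge_sup; first by exists (u x), x.
  (* A point [y] of the ball with [u y > a] would lie in [level u a] at distance less than [d] from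
     [x]. *)
  move=> _ [y /= zy <-]; rewrite leNgt; apply/negP => ay.
  have := xfar y (ltW ay); have := euclid_dist_triangle z x y.
  by rewrite (euclid_dist_sym x z); lra.
by rewrite -lerBlDr; apply: le_trans (supS _ _ zx).
Qed.

(** If [v x < u x], semicontinuity keeps [v] below some [b < u x] on an [r]-ball around [x]. At
    every level in []b, u x]] the point [x] is then [r]-far from the level of [v], which bounds [dp]
    below. *)
Lemma dp_separated u v : is_fuzzy u -> normal_fuzzy u -> is_fuzzy v ->
  normal_fuzzy v -> upper_semicontinuous v ->
  (forall e : R, 0 < e -> (dp p u v < e%:E)%E) -> forall x, u x <= v x.
Proof.
move=> fu nu fv nv sv H x; rewrite leNgt; apply/negP => vu.
have p0 : 0 < p by exact: lt_le_trans p1.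
have /andP[u0 u1] := fu x; have /andP[v0 v1] := fv x.
pose b := (v x + u x) / 2.
have vb : v x < b by rewrite /b; lra.
have bu : b < u x by rewrite /b; lra.
have /euclid_dist_nbhs[r r0 Hr] := sv x b vb.
have ub0 : 0 < u x - b by rewrite subr_gt0.
have q0 : 0 < r `^ p * (u x - b) by rewrite mulr_gt0// powR_gt0.
have e0 : 0 < (r `^ p * (u x - b)) `^ p^-1 by rewrite powR_gt0.
have := H _ e0; rewrite dp_lt// -powRrM mulVf ?gt_eqF// powRr1 ?(ltW q0)//.
apply/negP; rewrite -leNgt -int_pow_cst ?(ltW bu)//.
apply: (@le_trans _ _ (int_pow p `]b, u x] (level_dist u v))); last first.
  apply: int_pow_subset => //; first exact: measurable_level_dist.
  by move=> a /=; rewrite !in_itv/=; lra.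
apply: le_int_pow => //.
- exact: measurable_level_dist.
- by move=> a _; rewrite lee_fin ltW.
- move=> a /=; rewrite in_itv/= => /andP[ba au].
  apply: le_trans (excess_le_hausdorff _ _).
  apply: le_ereal_sup_tmp; exists (ereal_inf [set (euclid_dist x y)%:E | y in level v a]).
    by exists x.
  apply: le_ereal_inf_tmp => _ [y ay <-]; rewrite lee_fin leNgt; apply/negP => /Hr.
  by apply/negP; rewrite -leNgt (le_trans (ltW ba)).
Qed.

End bounded_fuzzy_sets.

(** * The space (X, d_p) *)

Section dp_space_topology.
Context {R : realType} {m : nat} (p : R) (X : set ('rV[R]_m -> R)).
Hypothesis p1 : 1 <= p.
Hypothesis Xn : forall u, X u -> normal_fuzzy u.
Implicit Types (s t : dp_space p X) (U : set ('rV[R]_m -> R)).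

Lemma dp_valP t : X (dp_val t).
Proof. exact: set_valP. Qed.

Lemma dp_val_normal t : normal_fuzzy (dp_val t).
Proof. exact/Xn/dp_valP. Qed.
Local Hint Resolve dp_val_normal : core.

Lemma dp_val_surj u : X u -> exists t, dp_val t = u.
Proof. by move=> Xu; exists (SigSub (mem_set Xu)). Qed.

Lemma nbhs_dp_space t (W : set (dp_space p X)) : nbhs t W <->
  exists2 e : R, 0 < e & forall s, (dp p (dp_val t) (dp_val s) < e%:E)%E -> W s.
Proof.
split=> [[B [oB Bt BW]]|[e e0 tW]].
  by have [e e0 te] := oB _ Bt; exists e => // s /te; exact: BW.
(* The points around which some ball lies in [W] form an open set, by the quasi-triangle inequality
   with factor 4. *)
exists [set s | exists2 d : R, 0 < d &
  forall r, (dp p (dp_val s) (dp_val r) < d%:E)%E -> W r]; split.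
- move=> s [d d0 sd]; have d4 : 0 < d / 4 by rewrite divr_gt0.
  exists (d / 4) => // r sr; exists (d / 4) => // q rq; apply: sd.
  exact: (dp_triangle_lt p1 d0 _ _ _ sr rq).
- by exists e.
- by move=> s [d d0]; apply; rewrite dp_self// lte_fin.
Qed.

Lemma closure_dp_space t U : closure (@dp_val R m p X @^-1` U) t <->
  forall e : R, 0 < e -> exists2 s : dp_space p X, U (dp_val s) & (dp p (dp_val t) (dp_val s) < e%:E)%E.
Proof.
split=> [cl e e0|H W /nbhs_dp_space[e e0 tW]].
  have [|s [Us ts]] := cl [set s | (dp p (dp_val t) (dp_val s) < e%:E)%E].
    by apply/nbhs_dp_space; exists e.
  by exists s.
by have [s Us ts] := H e e0; exists s; split=> //; exact: tW.
Qed.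

Lemma dp_closureP w U : U `<=` X -> dp_closure p X U w <->
  X w /\ forall e : R, 0 < e -> exists2 u, U u & (dp p w u < e%:E)%E.
Proof.
move=> UX; split=> [[t /closure_dp_space cl <-]|[Xw H]].
  split; first exact: dp_valP.
  by move=> e /cl[s Us ts]; exists (dp_val s).
have [t tw] := dp_val_surj Xw; exists t => //; apply/closure_dp_space => e /H[u Uu wu].
have [s su] := dp_val_surj (UX _ Uu); exists s; first by rewrite su.
by rewrite su tw.
Qed.

(* A filter containing the closure of [V] is refined by an ultrafilter on [V]
   containing the [V]-parts of the thickenings of its sets; any limit of the
   latter is a cluster point of the former. *)
Lemma compact_dp_closure U :
  (forall G : set_system (dp_space p X), UltraFilter G -> G (@dp_val R m p X @^-1` U) ->
    exists t, forall e : R, 0 < e ->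
      G [set s | (dp p (dp_val s) (dp_val t) < e%:E)%E]) ->
  compact (closure (@dp_val R m p X @^-1` U)).
Proof.
move=> H F PF FV; set V := _ @^-1` _ in H FV *.
pose thick (A : set (dp_space p X)) (e : R) : set (dp_space p X) :=
  [set s | V s /\ exists2 t, A t & (dp p (dp_val t) (dp_val s) < e%:E)%E].
pose F' : set_system (dp_space p X) :=
  [set S | exists A (e : R), [/\ F A, 0 < e & thick A e `<=` S]].
have PF' : ProperFilter F'.
  apply: Build_ProperFilter_ex.
    move=> S [A [e [FA e0 sub]]].
    have [t [At /closure_dp_space/(_ e e0)[s Vs ts]]] := @filter_ex _ F _ _ (filterI FA FV).
    by exists s; apply: sub; split=> //; exists t.
  split.
  - by exists setT, 1; split=> //; exact: filterT.
  - move=> S1 S2 [A1 [e1 [FA1 e10 sub1]]] [A2 [e2 [FA2 e20 sub2]]].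
    exists (A1 `&` A2), (Num.min e1 e2); split.
    + exact: filterI.
    + by rewrite lt_min e10.
    + move=> s [Vs [t [A1t A2t] ts]]; split; [apply: sub1|apply: sub2]; split=> //;
      exists t => //; apply: lt_le_trans ts _;
      by rewrite lee_fin ge_min lexx ?orbT.
  - move=> S1 S2 S12 [A [e [FA e0 sub]]]; exists A, e; split=> //.
    exact: subset_trans S12.
have [G [UG F'G]] := ultraFilterLemma PF'.
have GV : G V by apply: F'G; exists setT, 1; split=> //; [exact: filterT|move=> s []].
have [t Ht] := H G UG GV; exists t; split.
  apply/closure_dp_space => e e0.
  have [s [Vs st]] := @filter_ex _ G _ _ (filterI GV (Ht e e0)).
  exists s; first exact: Vs.
  by rewrite (dp_sym p (dp_val_normal t) (dp_val_normal s)).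
move=> A N FA /nbhs_dp_space[e e0 tN].
have e4 : 0 < e / 4 by rewrite divr_gt0.
have GA : G (thick A (e / 4)) by apply: F'G; exists A, (e / 4); split.
have [s [[_ [a Aa as_]] st]] := @filter_ex _ G _ _ (filterI GA (Ht _ e4)).
exists a; split=> //; apply: tN; rewrite dp_sym//.
exact: (dp_triangle_lt p1 e0 _ _ _ as_ st).
Qed.

End dp_space_topology.

(** * The two implications between relative compactness and the three conditions *)

Section relative_compactness.
Context {R : realType} {m : nat} (p : R) (X U : set ('rV[R]_m -> R)).
Hypothesis p1 : 1 <= p.
Hypothesis XF : X `<=` F_B R m.
Hypothesis UX : U `<=` X.

Let p_gt0 : 0 < p. Proof. exact: lt_le_trans p1. Qed.

Let Xn u : X u -> normal_fuzzy u. Proof. by move=> /XF[]. Qed.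

Let FBpn u : F_Bp R m p u -> normal_fuzzy u. Proof. by case. Qed.

Let U_F_Bp : U `<=` F_Bp R m p.
Proof. by move=> u /UX/XF; exact: F_B_sub_F_Bp. Qed.

Let powVK (e : R) : 0 <= e -> (e `^ p^-1) `^ p = e.
Proof. by move=> e0; rewrite -powRrM mulVf ?gt_eqF// powRr1. Qed.

Lemma conditions_imply_relatively_compact :
  uniformly_p_mean_bounded p U -> p_mean_equi_left_continuous p U ->
  dp_closure p (F_Bp R m p) U `<=` X -> dp_relatively_compact p X U.
Proof.
move=> [M M0 HM] Helc Hcl.
have Un u : U u -> normal_fuzzy u by move=> /UX/Xn.
have UM u : U u -> (int_pow p `]0%R, 1%R] (level_radius u) <= (M `^ p)%:E)%E.
  move=> Uu; have := HM u Uu; rewrite dp_zero_hat//; last exact: Un.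
  by rewrite poweRV_le// int_pow_ge0.
have Uelc e : 0 < e -> exists2 d : R, 0 < d &
    forall h : R, 0 <= h < d -> forall u, U u ->
    (int_pow p `]h, 1%R] (level_gap u h) <= e%:E)%E.
  move=> e0; have e1 : 0 < e `^ p^-1 by exact: powR_gt0.
  have [d d0 Hd] := Helc _ e1; exists d => // h hd u Uu.
  have := Hd h hd u Uu; case/andP: hd => h0 _.
  rewrite equi_left_integral//; last exact: Un.
  by rewrite powVK ?(ltW e0)// => /ltW.
apply: (compact_dp_closure p1 Xn) => G UG GU.
have UG' := ultrafilter_fmap (@dp_val R m p X) UG.
(* The limit is built among all functions, from the image ultrafilter; only condition (iii) then
   places it in [X]. *)
pose w := limit_fuzzy (@dp_val R m p X @ G).
have Fw : F_Bp R m p w by exact: (F_Bp_limit p1 Un UM Uelc UG' GU).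
have nw := FBpn Fw.
have Gw (e : R) : 0 < e -> G [set s | (dp p (dp_val s) w < e%:E)%E].
  move=> e0; have e2 : 0 < e `^ p / 2 by rewrite divr_gt0// powR_gt0.
  have := limit_dist p1 Un UM Uelc UG' GU e2; rewrite -/w => H.
  apply: (@filterS _ G _ _ _ _ H) => s /= sw.
  rewrite dp_lt//; last exact: dp_val_normal.
  rewrite (le_lt_trans sw)// lte_fin.
  by have := @powR_gt0 _ e p e0; lra.
have Xw : X w.
  apply: Hcl; apply/(dp_closureP p1 FBpn w U_F_Bp); split=> // e e0.
  have [s [Us sw]] := @filter_ex _ G _ _ (filterI GU (Gw e e0)).
  exists (dp_val s); first exact: Us.
  by rewrite (dp_sym p nw (dp_val_normal Xn s)).
by have [t tw] := dp_val_surj p Xw; exists t; rewrite tw.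
Qed.

Let dp_near (t : dp_space p X) (e : R) : 0 < e ->
  nbhs t [set s | (dp p (dp_val t) (dp_val s) < e%:E)%E].
Proof. by move=> e0; apply/(nbhs_dp_space p1 Xn); exists e. Qed.

(** Near each point of the closure all sufficiently large [M] are bounds; near-covering compactness
    with the filter at [+oo] makes one [M] work everywhere. *)
Lemma relatively_compact_bounded :
  dp_relatively_compact p X U -> uniformly_p_mean_bounded p U.
Proof.
rewrite /dp_relatively_compact compact_near_coveringP => cov.
have nz := @normal_zero_hat R m.
pose P (M : R) (t : dp_space p X) := (dp p (dp_val t) (zero_hat R m) <= M%:E)%E.
have HP : forall x, closure (@dp_val R m p X @^-1` U) x ->
    \forall x' \near x & M \near +oo, P M x'.
  move=> x _; have nx := dp_val_normal Xn x.
  have Fx := XF (dp_valP x); have [fx _ sx _] := Fx.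
  have x0 : (dp p (dp_val x) (zero_hat R m) < +oo)%E.
    have := F_B_sub_F_Bp p1 Fx; rewrite dp_zero_hat//.
    by move/(F_Bp_int_pow p1 fx nx sx); exact: poweR_lty.
  have [r r0 xr] : exists2 r : R, 0 < r & (dp p (dp_val x) (zero_hat R m) < (r / 4)%:E)%E.
    move: x0; rewrite dpE//; case E : (_ `^ _)%E => [r||]// _.
      have r0 : 0 <= r by rewrite -lee_fin -E poweR_ge0.
      by exists (4 * (r + 1)); [lra|rewrite lte_fin; lra].
    by exists 4; rewrite // ltNyr.
  have r4 : 0 < r / 4 by rewrite divr_gt0.
  exists ([set s | (dp p (dp_val x) (dp_val s) < (r / 4)%:E)%E], [set M | r <= M]).
    by split; [exact: dp_near|exact: (nbhs_pinfty_ge (num_real r))].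
  move=> [s M] [/= xs rM]; apply: (@le_trans _ _ r%:E); last by rewrite lee_fin.
  have ns := dp_val_normal Xn s; apply/ltW.
  by apply: (dp_triangle_lt p1 r0 ns nx nz _ xr); rewrite dp_sym.
have [M [HM M0]] := @filter_ex _ _ _ _
  (filterI (cov R (pinfty_nbhs R) P _ HP) (nbhs_pinfty_gt (num_real 0))).
exists M => // u Uu; have [t tu] := dp_val_surj p (UX Uu).
by rewrite -tu; apply: HM; apply: subset_closure; rewrite /= tu.
Qed.

(** Goes from [level v a] to [level v (a - h)] through [level u a] and [level u (a - h)]; the last
    leg is a translated [level_dist]. *)
Lemma int_pow_gap_le (u v : 'rV[R]_m -> R) (h : R) : normal_fuzzy u ->
  normal_fuzzy v -> 0 <= h ->
  (int_pow p `]h, 1%R] (level_gap v h) <= (2 `^ p)%:E *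
    (int_pow p `]0%R, 1%R] (level_dist u v) + (2 `^ p)%:E *
      (int_pow p `]h, 1%R] (level_gap u h) +
       int_pow p `]0%R, 1%R] (level_dist u v))))%E.
Proof.
move=> nu nv h0.
have dom a : `]h, 1]%classic a -> a <= 1 /\ a - h <= 1.
  by rewrite /= in_itv/=; lra.
have m1 : measurable_fun `]h, 1] (level_dist u v) by exact: measurable_level_dist.
have m2 : measurable_fun `]h, 1] (level_gap u h) by exact: measurable_level_gap.
have m3 : measurable_fun `]h, 1] (fun a => level_dist u v (a - h)).
  apply: (@measurable_hausdorff_level _ _ _ u v (fun a => a - h) (fun a => a - h)) => //.
  - by move=> a b ab; rewrite lerD2r.
  - by move=> a b ab; rewrite lerD2r.
  - by move=> a /dom[].
  - by move=> a /dom[].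
have g1 a : `]h, 1]%classic a -> (0 <= level_dist u v a)%E.
  by move=> /dom[? _]; exact: level_dist_ge0.
have g2 a : `]h, 1]%classic a -> (0 <= level_gap u h a)%E.
  by move=> /dom[? _]; exact: level_gap_ge0.
have g3 a : `]h, 1]%classic a -> (0 <= level_dist u v (a - h))%E.
  by move=> /dom[_ ?]; exact: level_dist_ge0.
have c0 : (0 < (2 `^ p)%:E)%E by rewrite lte_fin powR_gt0.
apply: (@le_trans _ _ ((2 `^ p)%:E * (int_pow p `]h, 1%R] (level_dist u v) +
    int_pow p `]h, 1%R] (fun a => level_gap u h a + level_dist u v (a - h))))%E).
  apply: int_powD_le => //.
  - exact: measurable_level_gap.
  - exact: emeasurable_funD.
  - by move=> a /dom[? _]; exact: level_gap_ge0.
  - by move=> a Da; apply: adde_ge0; [exact: g2|exact: g3].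
  - move=> a /dom[a1 ah1]; rewrite level_distC.
    apply: le_trans (hausdorff_dist_triangle (level_nonempty nv a1)
      (level_nonempty nu a1) (level_nonempty nv ah1)) _.
    apply: leeD2l; rewrite (level_distC v u).
    by apply: hausdorff_dist_triangle; exact: level_nonempty.
rewrite lee_pmul2l//; apply: leeD.
  apply: int_pow_subset => //; first exact: measurable_level_dist.
  by move=> a /=; rewrite !in_itv/=; lra.
apply: le_trans (int_powD_le p1 _ _ m2 m3 _ g2 g3 _) _ => //.
- exact: emeasurable_funD.
- by move=> a Da; apply: adde_ge0; [exact: g2|exact: g3].
rewrite lee_pmul2l//; apply: leeD => //.
rewrite (@int_pow_shift _ p (- h) h 1 (level_dist u v)); last first.
  by apply: measurable_level_dist => //; lra.
apply: int_pow_subset => //; first exact: measurable_level_dist.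
by move=> a /=; rewrite !in_itv/=; lra.
Qed.

(** Each point of the closure has its own [d], which persists nearby by [int_pow_gap_le];
    near-covering compactness with the filter at [0^'+] gives a common one. *)
Lemma relatively_compact_equi_left_continuous :
  dp_relatively_compact p X U -> p_mean_equi_left_continuous p U.
Proof.
rewrite /dp_relatively_compact compact_near_coveringP => cov eps eps0.
pose c : R := 2 `^ p.
have c0 : 0 < c by exact: powR_gt0.
have ep0 : 0 < eps `^ p by exact: powR_gt0.
have cc0 : 0 < c + 2 * c * c by rewrite addr_gt0// !mulr_gt0.
pose k := eps `^ p / (2 * (c + 2 * c * c)).
have k0 : 0 < k by rewrite divr_gt0// mulr_gt0.
have k1 : 0 < k `^ p^-1 by exact: powR_gt0.
pose P (d : R) (t : dp_space p X) := forall h, 0 <= h < d ->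
  (int_pow p `]h, 1%R] (level_gap (dp_val t) h) < (eps `^ p)%:E)%E.
have HP : forall x, closure (@dp_val R m p X @^-1` U) x ->
    \forall x' \near x & d \near 0^'+, P d x'.
  move=> x _; have nx := dp_val_normal Xn x.
  have [d d0 Hd] := F_B_equi_left_continuous p1 (XF (dp_valP x)) k0.
  exists ([set s | (dp p (dp_val x) (dp_val s) < (k `^ p^-1)%:E)%E], [set d' | d' < d]).
    by split; [exact: dp_near|exact: nbhs_right_lt].
  move=> [s d'] [/= xs dd'] h /andP[h0 hd].
  have ns := dp_val_normal Xn s.
  have hd' : 0 <= h < d by rewrite h0 (lt_trans hd).
  move: xs; rewrite dp_lt// powVK ?(ltW k0)// => xs.
  apply: le_lt_trans (int_pow_gap_le nx ns h0) _; rewrite -/c.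
  apply: (@le_lt_trans _ _ (c%:E * (k%:E + c%:E * (k%:E + k%:E)))%E).
    have xs' := ltW xs; have Hdh := Hd _ hd'.
    rewrite lee_pmul2l ?lte_fin//; apply: leeD => //.
    by rewrite lee_pmul2l ?lte_fin//; apply: leeD.
  rewrite -!(EFinD, EFinM) lte_fin (_ : c * _ = eps `^ p / 2); first by lra.
  by rewrite /k; field; rewrite gt_eqF//=; lra.
have cover := cov R (0^'+) P (at_right_proper_filter 0) HP.
have [d [Hd d0]] := @filter_ex _ _ (at_right_proper_filter (0 : R)) _
  (filterI cover (nbhs_right_gt 0)).
exists d => // h hd u Uu; have [t tu] := dp_val_surj p (UX Uu).
case/andP: (hd) => h0 _; rewrite equi_left_integral//; last exact/Xn/UX.
by rewrite -tu; apply: Hd hd; apply: subset_closure; rewrite /= tu.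
Qed.

(** The traces on [U] of the balls around [w] generate a filter, which by compactness has a cluster
    point [t] in [X]; then [w] and [t] are at distance 0, hence equal. *)
Lemma relatively_compact_closure_sub :
  dp_relatively_compact p X U -> dp_closure p (F_Bp R m p) U `<=` X.
Proof.
move=> cpt w /(dp_closureP p1 FBpn w U_F_Bp)[Fw Hw].
have nw := FBpn Fw; have [fw _ sw _] := Fw.
pose F : set_system (dp_space p X) := [set S | exists2 e : R, 0 < e &
  [set s | U (dp_val s) /\ (dp p w (dp_val s) < e%:E)%E] `<=` S].
have PF : ProperFilter F.
  apply: Build_ProperFilter_ex.
    move=> S [e e0 sub]; have [u Uu wu] := Hw e e0.
    by have [s su] := dp_val_surj p (UX Uu); exists s; apply: sub; rewrite /= su.
  split.
  - by exists 1.
  - move=> S1 S2 [e1 e10 sub1] [e2 e20 sub2]; exists (Num.min e1 e2).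
      by rewrite lt_min e10.
    by move=> s [Us ws]; split; [apply: sub1|apply: sub2]; split=> //;
      apply: lt_le_trans ws _; rewrite lee_fin ge_min lexx ?orbT.
  - by move=> S1 S2 S12 [e e0 sub]; exists e => //; exact: subset_trans S12.
have FK : F (closure (@dp_val R m p X @^-1` U)).
  by exists 1 => // s [Us _]; exact: subset_closure.
have [t [_ clt]] := cpt F PF FK.
have nt := dp_val_normal Xn t; have [ft _ st _] := XF (dp_valP t).
have wt e : 0 < e -> (dp p w (dp_val t) < e%:E)%E.
  move=> e0; have e4 : 0 < e / 4 by rewrite divr_gt0.
  have [|s [[_ ws] ts]] := clt [set s | U (dp_val s) /\ (dp p w (dp_val s) < (e / 4)%:E)%E]
    [set s | (dp p (dp_val t) (dp_val s) < (e / 4)%:E)%E] _ (dp_near t e4).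
    by exists (e / 4).
  have ns := dp_val_normal Xn s.
  by apply: (dp_triangle_lt p1 e0 nw ns nt ws); rewrite dp_sym.
suff -> : w = dp_val t by exact: dp_valP.
apply/funext => x; apply/le_anti/andP; split.
  exact: (dp_separated p1 fw nw ft nt st wt).
by apply: (dp_separated p1 ft nt fw nw sw) => e e0; rewrite dp_sym// wt.
Qed.

End relative_compactness.

Theorem theorem6p15 (R : realType) (m : nat) (p : R)
    (X U : set ('rV[R]_m -> R)) (hm : (1 <= m)%N) (hp : 1 <= p)
    (hX : [\/ X = Stilde R m, X = Em R m, X = S0m R m | X = Sm R m])
    (hU : U `<=` X) :
  dp_relatively_compact p X U <->
  [/\ uniformly_p_mean_bounded p U,
      p_mean_equi_left_continuous p U &
      dp_closure p (F_Bp R m p) U `<=` X].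
Proof.
(* The four classes are treated at once through their common inclusion in [F_B]. *)
have XF : X `<=` F_B R m by case: hX => -> u [].
split=> [cpt|[bnd elc cl]]; last exact: conditions_imply_relatively_compact.
split.
- exact: (relatively_compact_bounded hp XF hU cpt).
- exact: (relatively_compact_equi_left_continuous hp XF hU cpt).
- exact: (relatively_compact_closure_sub hp XF hU cpt).
Qed.
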